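(* For every $\varepsilon>0$ there exist constants $c=c(\varepsilon)>0$ and $c'=c'(\varepsilon)>0$ such that for every prime $p$ and every interval $I\subset\mathbb{F}_p\setminus\{0\}$ with $|I|<p^{1/18}$, the number $J_6$ of solutions of $$x_1^{-1}+x_2^{-1}+x_3^{-1}=x_4^{-1}+x_5^{-1}+x_6^{-1}\quad\text{in }\mathbb{F}_p,\qquad x_1,\dots,x_6\in I,$$ satisfies $$J_6<c\,|I|^{3+\varepsilon}.$$ In particular, for such $I$, $$|I^{-1}+I^{-1}+I^{-1}|>c'\,|I|^{3-\varepsilon}.$$
   Context: $\mathbb{F}_p$ is the field of residue classes modulo the prime $p$; $x^{-1}$ is the inverse in $\mathbb{F}_p$, $I^{-1}=\{x^{-1}:x\in I\}$ and $I^{-1}+I^{-1}+I^{-1}$ is the set of all sums of three elements of $I^{-1}$. An interval $I$ in $\mathbb{F}_p$ is a non-empty set of residue classes of consecutive integers $M+1,\dots,M+N$ with $1\le N\le p$, and $|I|=N$. *)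

(* Defs.v *)
From HB Require Import structures.
From mathcomp Require Import all_boot all_order all_algebra.
From mathcomp Require Import reals exp.

Set Implicit Arguments.
Unset Strict Implicit.
Unset Printing Implicit Defensive.

Import Order.TTheory GRing.Theory Num.Theory.
Local Open Scope ring_scope.

(* The bound N <= p makes the N residues distinct (for p prime), so that
   #|I| = N. *)
Definition is_interval (p : nat) (I : {set 'F_p}) : Prop :=
  exists (M : int) (N : nat),
    (1 <= N <= p)%N /\ I = [set (M + k.+1%:Z)%:~R | k : 'I_N].

Definition invset (F : finFieldType) (A : {set F}) : {set F} :=
  [set x^-1 | x in A].

Definition sumset (F : finFieldType) (A B : {set F}) : {set F} :=
  [set a + b | a in A, b in B].

Definition J6 (F : finFieldType) (I : {set F}) : nat :=
  #|[set x : F * F * F * F * F * F |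
      let: (x1, x2, x3, x4, x5, x6) := x in
      [&& x1 \in I, x2 \in I, x3 \in I, x4 \in I, x5 \in I, x6 \in I
        & x1^-1 + x2^-1 + x3^-1 == x4^-1 + x5^-1 + x6^-1]]|.

(* Main.v *)
Require Import Defs.
From HB Require Import structures.
From mathcomp Require Import all_boot all_order all_algebra.
From mathcomp Require Import reals exp.
From mathcomp Require Import zify ring lra.

(** Write the interval as [a + x], [0 <= x < N], and group the solutions by the
    common value [lam] of the two sides.  If [s1, s2, s3] are the elementary
    symmetric functions of [x1, x2, x3], the equation
    [1/(a+x1) + 1/(a+x2) + 1/(a+x3) = lam] is linear in [s1, s2, s3] with
    coefficients depending on [a] and [lam], so for [N^6 << p] the integer
    points [(s1, s2, s3)] of one fiber lie on a plane over [Q].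

    If they lie on a line, the cubics [prod_i (Z - x_i)] form a pencil
    [g0 + t Q], and each [Q(x_i)] divides the fixed resultant of [g0] and [Q]:
    the divisor bound leaves few triples.

    Otherwise they span the plane, and the equation of that plane is the
    polarization of an integer binary cubic [f] which is congruent mod [p] to a
    multiple of [(Z + a)^2 (lam (Z + a) - 3)].  The discriminant of [f] is a
    multiple of [p] of size [O(N^18)], hence it vanishes: [f] has a rational
    double root [-alpha], with [alpha] congruent to [a] and of height so small
    that it is unique.  All such solutions therefore satisfy the original
    equation over [Q] with [alpha] in place of [a].  With [alpha = u/v] and
    [y = u + v x], each of the six [y]'s divides the product of the others;
    ordering them, [y_i] divides [A_i B_i], where [A_i] (resp. [B_i]) is its gcd
    with the product of the preceding (resp. following) ones, and counting in
    one of the two directions gives [N^(3 + o(1))] solutions. *)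

Set Implicit Arguments.
Unset Strict Implicit.
Unset Printing Implicit Defensive.

Import Order.TTheory GRing.Theory Num.Theory.

(** * The divisor bound *)

Lemma dvdn_mul_gcd n a b : n %| a * b -> n %| gcdn n a * gcdn n b.
Proof.
move=> nab; rewrite muln_gcdl !muln_gcdr !dvdn_gcd nab.
by rewrite dvdn_mulr // dvdn_mulr // dvdn_mull.
Qed.

(** A divisor of [q ^ e * m] is the product of its gcds with [q ^ e] and with [m], and the first of
    these takes at most [e.+1] values. *)
Lemma size_divisors_pfactor q e m : prime q -> coprime q m -> 0 < m ->
  size (divisors (q ^ e * m)) <= e.+1 * size (divisors m).
Proof.
move=> q_pr cqm m_gt0; have q_gt0 := prime_gt0 q_pr.
rewrite -[e.+1](size_iota 0) -(size_allpairs (fun i d => q ^ i * d)).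
apply: uniq_leq_size (divisors_uniq _) _ => d.
rewrite -dvdn_divisors ?muln_gt0 ?expn_gt0 ?q_gt0 // => d_dvd.
have cqe : coprime (gcdn d (q ^ e)) (gcdn d m).
  apply: coprime_dvdl (dvdn_gcdr _ _) _; apply: coprime_dvdr (dvdn_gcdr _ _) _.
  exact: coprimeXl.
have -> : d = gcdn d (q ^ e) * gcdn d m.
  apply/eqP; rewrite eqn_dvd dvdn_mul_gcd //= Gauss_dvd //.
  by rewrite !dvdn_gcdl.
have /(dvdn_pfactor _ _ q_pr) [i le_ie ->] := dvdn_gcdr d (q ^ e).
apply: allpairs_f; first by rewrite mem_iota.
by rewrite -dvdn_divisors // dvdn_gcdr.
Qed.

(** Raise [e.+1 <= K * (e %/ K).+1 <= K * 2 ^ (e %/ K)] to the power [K]. *)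
Lemma expSn_leq_exp2 K e : 0 < K -> e.+1 ^ K <= K ^ K * 2 ^ e.
Proof.
move=> K_gt0; apply: (@leq_trans ((K * 2 ^ (e %/ K)) ^ K)).
  rewrite leq_exp2r //; apply: (@leq_trans (K * (e %/ K).+1)).
    by rewrite mulnC ltn_ceil.
  by rewrite leq_mul2l ltn_expl // orbT.
by rewrite expnMn leq_mul2l -expnM leq_exp2l // leq_trunc_div orbT.
Qed.

(* Primes [q >= 2 ^ K] satisfy [(e + 1) ^ K <= q ^ e]; each of the remaining
   ones costs a factor [K ^ K]. *)
Lemma size_divisors_exp_aux K j n : 0 < K -> 0 < n ->
  (forall q, prime q -> q %| n -> 2 ^ K <= q + j) ->
  size (divisors n) ^ K <= (K ^ K) ^ j * n.
Proof.
move=> K_gt0; elim: j n => [|j IHj] n n_gt0 qP.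
  rewrite expn0 mul1n; have [k] := ubnP n.
  elim: k n n_gt0 qP => // k IHk n n_gt0 qP le_nk.
  have [n_gt1|n_le1] := ltnP 1 n; last first.
    have -> : n = 1 by apply/eqP; rewrite eqn_leq n_le1.
    by rewrite /= exp1n.
  have q_pr := pdiv_prime n_gt1; set q := pdiv n in q_pr.
  have := qP q q_pr (pdiv_dvd n); rewrite addn0 => le_q.
  have [m cqm def_n] := pfactor_coprime q_pr n_gt0.
  set e := logn q n in def_n; have m_gt0 : 0 < m.
    by move: n_gt0; rewrite def_n muln_gt0 => /andP[].
  have e_gt0 : 0 < e by rewrite logn_gt0 mem_primes q_pr n_gt0 pdiv_dvd.
  have IHm : size (divisors m) ^ K <= m.
    apply: (IHk m m_gt0) => [r r_pr r_dvd|].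
      by apply: (qP r r_pr); rewrite def_n dvdn_mulr.
    apply: leq_trans (_ : n <= k); last by rewrite -ltnS.
    rewrite def_n -[X in X < _]muln1 ltn_pmul2l //.
    by rewrite -(expn0 q) ltn_exp2l // prime_gt1.
  rewrite [in X in X <= _]def_n mulnC.
  apply: leq_trans (_ : (e.+1 * size (divisors m)) ^ K <= _).
    by rewrite leq_exp2r // size_divisors_pfactor.
  rewrite expnMn [in X in _ <= X]def_n mulnC leq_mul //.
  apply: leq_trans (_ : (2 ^ K) ^ e <= _); last by rewrite leq_exp2r.
  by rewrite -expnM mulnC expnM leq_exp2r // ltn_expl.
(* Passing from [j] to [j.+1] admits only one new prime factor, [2 ^ K - j.+1]; the second conjunct
   rules out a truncated subtraction. *)
have [/andP[q_pr q_lt]|] := boolP (prime (2 ^ K - j.+1) && (j.+1 <= 2 ^ K)); last first.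
  move=> nq; apply: leq_trans (IHj n n_gt0 _) _ => [q q_pr q_dvd|].
    have := qP q q_pr q_dvd; rewrite addnS leq_eqVlt => /orP[/eqP eq_q|]; last by [].
    case/negP: nq; have -> : 2 ^ K - j.+1 = q by lia.
    by rewrite q_pr; lia.
  by rewrite leq_mul2r leq_pexp2l ?leqnSn ?orbT // expn_gt0 K_gt0.
set q := _ - _ in q_pr.
have [m cqm def_n] := pfactor_coprime q_pr n_gt0.
set e := logn q n in def_n; have m_gt0 : 0 < m.
  by move: n_gt0; rewrite def_n muln_gt0 => /andP[].
have IHm : size (divisors m) ^ K <= (K ^ K) ^ j * m.
  apply: IHj => // r r_pr r_dvd.
  have := qP r r_pr; rewrite def_n dvdn_mulr // => /(_ isT).
  rewrite addnS leq_eqVlt => /orP[/eqP eq_r|//].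
  have r_q : r = q by rewrite /q; lia.
  move: cqm; rewrite -r_q prime_coprime // r_dvd //.
rewrite [in X in X <= _]def_n mulnC.
apply: leq_trans (_ : (e.+1 * size (divisors m)) ^ K <= _).
  by rewrite leq_exp2r // size_divisors_pfactor.
rewrite expnMn [in X in _ <= X]def_n.
have -> : (K ^ K) ^ j.+1 * (m * q ^ e) = (K ^ K * q ^ e) * ((K ^ K) ^ j * m).
  by rewrite expnS; ring.
rewrite leq_mul //; apply: leq_trans (expSn_leq_exp2 _ K_gt0) _.
rewrite leq_mul2l; apply/orP; right.
have [->|e_gt0] := posnP e; first by [].
by rewrite leq_exp2r // prime_gt1.
Qed.

(** With [j = 2 ^ K] the condition on the primes is vacuous. This is the classical bound
    [d(n) << n^(1/K)]. *)
Lemma size_divisors_exp K : 0 < K ->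
  exists2 C, 0 < C & forall n, 0 < n -> size (divisors n) ^ K <= C * n.
Proof.
move=> K_gt0; exists ((K ^ K) ^ (2 ^ K)); first by rewrite !expn_gt0 K_gt0.
by move=> n n_gt0; apply: size_divisors_exp_aux => // q _ _; apply: leq_addl.
Qed.

Local Open Scope ring_scope.

(** * Sums of reciprocals over Q *)

Lemma card_le_size (T : finType) (U : eqType) (f : T -> U) (A : {pred T})
    (s : seq U) :
  {in A &, injective f} -> (forall x, x \in A -> f x \in s) ->
  (#|A| <= size s)%N.
Proof.
move=> f_inj f_s; rewrite cardE -(size_map f); apply: uniq_leq_size.
  rewrite map_inj_in_uniq ?enum_uniq // => x y.
  by rewrite !mem_enum; apply: f_inj.
by move=> _ /mapP[x xA ->]; apply: f_s; rewrite mem_enum in xA.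
Qed.

Lemma sum_pairE (V : nmodType) (A B : finType) (F : A * B -> V) :
  \sum_z F z = \sum_x \sum_y F (x, y).
Proof. by rewrite pair_bigA; apply: eq_bigr => -[]. Qed.

(** Dyadic blocks: the terms with [2 ^ j <= m < 2 ^ j.+1] add up to at most 1. *)
Lemma harmonic_le_log2 M :
  \sum_(1 <= m < M.+1) (m%:R^-1 : rat) <= (trunc_log 2 M).+1%:R.
Proof.
have H j : \sum_(1 <= m < 2 ^ j) (m%:R^-1 : rat) <= j%:R.
  elim: j => [|j IHj]; first by rewrite big_nil.
  have le_j : (1 <= 2 ^ j)%N by rewrite expn_gt0.
  rewrite (big_cat_nat le_j) /=; last by rewrite leq_exp2l.
  rewrite -natr1 lerD //.
  apply: (@le_trans _ _ (\sum_(2 ^ j <= m < 2 ^ j.+1) ((2 ^ j)%:R^-1 : rat))).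
    rewrite big_seq [leRHS]big_seq; apply: ler_sum => m.
    rewrite mem_index_iota => /andP[le_m _].
    by rewrite lef_pV2 ?ler_nat // posrE ltr0n // (leq_trans _ le_m).
  rewrite sumr_const_nat expnS mul2n -addnn addnK.
  by rewrite -[leLHS]mulr_natl divff // pnatr_eq0 -lt0n.
apply: le_trans _ (H (trunc_log 2 M).+1).
have le_M : (M.+1 <= 2 ^ (trunc_log 2 M).+1)%N by apply: trunc_log_ltn.
by rewrite (big_cat_nat _ le_M) //= lerDl sumr_ge0 // => m _; rewrite invr_ge0.
Qed.

(** After clearing denominators, the cofactor of [y] is the fourth elementary symmetric polynomial
    of [a, b, c, d, e]. *)
Lemma dvdz_inv_sum (y a b c d e : int) : y != 0 -> a != 0 -> b != 0 -> c != 0 ->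
    d != 0 -> e != 0 ->
  y%:~R^-1 = a%:~R^-1 + b%:~R^-1 + c%:~R^-1 + d%:~R^-1 + e%:~R^-1 :> rat ->
  (`|y| %| `|a| * `|b| * `|c| * `|d| * `|e|)%N.
Proof.
move=> y0 a0 b0 c0 d0 e0 eq_y; rewrite -!abszM -/(dvdz _ _).
apply/dvdzP; exists (b * c * d * e + a * c * d * e + a * b * d * e
  + a * b * c * e + a * b * c * d).
apply: (@intr_inj rat); rewrite !(rmorphM, rmorphD) /=.
have -> : (a%:~R * b%:~R * c%:~R * d%:~R * e%:~R : rat) =
  a%:~R * b%:~R * c%:~R * d%:~R * e%:~R * y%:~R^-1 * y%:~R.
  by rewrite mulfVK // intr_eq0.
congr (_ * _); rewrite eq_y; field.
by rewrite !intr_eq0 e0 d0 c0 b0 a0.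
Qed.

Section ReciprocalSums.

Variables (N M D : nat) (u v : int).
Hypotheses (N_gt0 : (0 < N)%N)
  (D_bound : forall m, (0 < m <= M ^ 5)%N -> (size (divisors m) <= D)%N).
Hypotheses (v_neq0 : v != 0) (coprime_uv : coprime `|u| `|v|).

Let y (k : 'I_N) : int := u + v * k%:Z.
Let n k := `|y k|%N.
Hypothesis n_bound : forall k, (0 < n k <= M)%N.

(* Up to constants [weight A m] is [A / min N m], at most 1: once [A] is known
   to divide [m = n k], its inverse bounds the number of choices left for [k]. *)
Let weight (A m : nat) : rat := Num.min 1 (A%:R * (N%:R^-1 + m%:R^-1)).

Let M_gt0 : (0 < M)%N.
Proof. by have /andP[] := n_bound (Ordinal N_gt0); apply: leq_trans. Qed.

Let y_inj : injective y.
Proof.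
by move=> i j /addrI /(mulfI v_neq0) [] /val_inj.
Qed.

Let weight_ge0 A m : 0 <= weight A m.
Proof. by rewrite le_min ler01 mulr_ge0 // addr_ge0 // invr_ge0 ler0n. Qed.

(** Let [t = 1/N + 1/m], so that [m t >= 1]. If neither minimum is 1, the product is
    [A B t^2 >= m t^2 >= t]; if one of them is 1, the other is still at least [1/N]. *)
Let weight_mul A B m : (0 < m)%N -> (0 < A)%N -> (0 < B)%N -> (m <= A * B)%N ->
  N%:R^-1 <= weight A m * weight B m.
Proof.
move=> m_gt0 A_gt0 B_gt0 mAB; rewrite /weight.
set t := (N%:R^-1 + m%:R^-1 : rat).
have Ni_gt0 : 0 < (N%:R^-1 : rat) by rewrite invr_gt0 ltr0n.
have mi_gt0 : 0 < (m%:R^-1 : rat) by rewrite invr_gt0 ltr0n.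
have Ni_le1 : (N%:R^-1 : rat) <= 1 by rewrite invf_le1 ?ler1n ?ltr0n.
have A_ge1 : 1 <= A%:R :> rat by rewrite ler1n.
have B_ge1 : 1 <= B%:R :> rat by rewrite ler1n.
have t_ge : N%:R^-1 <= t by rewrite lerDl ltW.
have mt_ge1 : 1 <= m%:R * t.
  rewrite mulrDr [X in _ + X]mulfV ?pnatr_eq0 -?lt0n // lerDr.
  by rewrite mulr_ge0 ?ler0n // ltW.
have mAB' : m%:R <= A%:R * B%:R :> rat by rewrite -natrM ler_nat.
have t_gt0 : 0 < t by apply: lt_le_trans t_ge.
have ge_t C : 1 <= C -> N%:R^-1 <= C * t.
  by move=> C1; apply: le_trans t_ge _; rewrite ler_peMl // ltW.
have [le1|lt1] := leP 1 (A%:R * t); have [le2|lt2] := leP 1 (B%:R * t);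
  rewrite ?mul1r ?mulr1 ?ge_t //.
apply: le_trans t_ge _; rewrite mulrACA -[leLHS]mul1r.
apply: le_trans (_ : m%:R * t * t <= _); first by rewrite ler_pM2r.
by rewrite mulrA ler_pM2r // ler_pM2r.
Qed.

(** A divisor [A] of some [u + v k] is prime to [v], since [u] and [v] are coprime. The admissible
    [k] thus lie in one class modulo [A], and [k %/ A] determines [k]. *)
Let card_dvd A : (0 < A)%N -> (#|[set k | (A %| n k)%N]| <= (N %/ A).+1)%N.
Proof.
move=> A_gt0; rewrite -(size_iota 0 (N %/ A).+1).
apply: (@card_le_size _ _ (fun k : 'I_N => k %/ A)%N) => [i j|i _]; last first.
  by rewrite mem_iota /= add0n ltnS leq_div2r // ltnW.
rewrite !inE => Ai Aj eq_ij.
have cAv : coprime A `|v|%N.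
  rewrite /coprime -dvdn1 -(eqP coprime_uv) dvdn_gcd dvdn_gcdr andbT.
  have : (gcdn A `|v| %| y i)%Z by apply: dvdn_trans (dvdn_gcdl _ _) Ai.
  rewrite /y rpredDr; first by [].
  by rewrite dvdz_mulr // dvdzE /= dvdn_gcdr.
have : (A %| y i - y j)%Z by rewrite rpredB.
have -> : y i - y j = v * (i%:Z - j%:Z) by rewrite /y; ring.
rewrite dvdzE abszM /= Gauss_dvdr // => A_ij.
apply: val_inj; apply/eqP => /=.
wlog le_ij : i j Ai Aj eq_ij A_ij / (i <= j)%N => [W|].
  have /orP[le|le] := leq_total i j; first exact: W.
  by rewrite eq_sym; apply: W => //; rewrite distnC.
move: A_ij; rewrite distnEr // => A_ij.
have mod_ij : (j %% A = i %% A)%N by apply/eqP; rewrite eqn_mod_dvd.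
by rewrite (divn_eq i A) (divn_eq j A) eq_ij mod_ij.
Qed.

Let card_n m : (#|[set k | n k == m]| <= 2)%N.
Proof.
apply: (@card_le_size _ _ y _ [:: m%:Z; - m%:Z]) => [i j _ _|i]; first exact: y_inj.
rewrite !inE => /eqP <-; rewrite /n abszE.
by case: (ger0P (y i)) => _; rewrite ?opprK eqxx ?orbT.
Qed.

Let D_gt0 : (0 < D)%N.
Proof. by apply: leq_trans (D_bound (m := 1%N) _); rewrite // expn_gt0 M_gt0. Qed.

(** Logarithms are absorbed into [D]: the largest power [2 ^ j <= M] already has [j.+1] divisors. *)
Let harmonic_le_D : \sum_(1 <= m < M.+1) (m%:R^-1 : rat) <= D%:R.
Proof.
apply: le_trans (harmonic_le_log2 M) _; rewrite ler_nat.
set j := trunc_log 2 M.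
have : (size (divisors (2 ^ j)) <= D)%N.
  apply: D_bound; rewrite expn_gt0 /= (leq_trans (trunc_logP _ M_gt0)) //.
  by rewrite -[X in (X <= _)%N]expn1 leq_pexp2l.
apply: leq_trans.
have -> : j.+1 = size [seq (2 ^ i)%N | i <- iota 0 j.+1] by rewrite size_map size_iota.
apply: uniq_leq_size => [|_ /mapP[i + ->]].
  by rewrite map_inj_uniq ?iota_uniq // => a b /eqP; rewrite eqn_exp2l // => /eqP.
rewrite mem_iota => /andP[_ le_i].
by rewrite -dvdn_divisors ?expn_gt0 // dvdn_exp2l.
Qed.

(** Write [n k = A m]: each [m <= M] arises from at most two [k], which leaves twice the harmonic
    sum. *)
Let sum_inv_dvd A : (0 < A)%N ->
  \sum_(k | (A %| n k)%N) (A%:R / (n k)%:R : rat) <= 2 * D%:R.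
Proof.
move=> A_gt0.
apply: le_trans (_ : 2 * \sum_(1 <= m < M.+1) (m%:R^-1 : rat) <= _); last first.
  by rewrite ler_pM2l.
have le_k k : (A %| n k)%N -> A%:R / (n k)%:R <=
    \sum_(1 <= m < M.+1) (if n k == (A * m)%N then m%:R^-1 else 0 : rat).
  move=> Ak; have [n_gt0 n_leM] := andP (n_bound k).
  have q_gt0 : (0 < n k %/ A)%N by rewrite divn_gt0 // dvdn_leq.
  rewrite (bigD1_seq (n k %/ A)%N) ?iota_uniq //=; last first.
    by rewrite mem_index_iota q_gt0 ltnS (leq_trans (leq_div _ _)).
  rewrite [in n k == _]mulnC divnK // eqxx -[leLHS]addr0 lerD //.
    rewrite -{1}(divnK Ak) natrM invfM mulrCA mulfV ?mulr1 //.
    by rewrite pnatr_eq0 -lt0n.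
  by apply: sumr_ge0 => m _; case: ifP => // _; rewrite invr_ge0.
apply: le_trans (ler_sum _ le_k) _.
rewrite exchange_big /= mulr_sumr; apply: ler_sum => m _.
apply: (@le_trans _ _ (\sum_(k | n k == (A * m)%N) (m%:R^-1 : rat))).
  rewrite -big_mkcondr /= big_mkcond [leRHS]big_mkcond /=.
  apply: ler_sum => k _; case: (n k == _); rewrite ?andbF ?andbT //.
  by case: ifP; rewrite // invr_ge0.
rewrite sumr_const -[leLHS]mulr_natl ler_wpM2r ?invr_ge0 ?ler_nat //.
by rewrite -cardsE card_n.
Qed.

(** The weight is at most [min(1, A/N) + A / n k]. The first part is summed over at most [N/A + 1]
    indices and contributes at most 2; the second is handled by [sum_inv_dvd]. *)
Let sum_weight_dvd A : (0 < A)%N ->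
  \sum_(k | (A %| n k)%N) weight A (n k) <= 4 * D%:R.
Proof.
move=> A_gt0; set t : rat := Num.min 1 (A%:R / N%:R).
have t_ge0 : 0 <= t by rewrite le_min ler01 divr_ge0 ?ler0n.
apply: (@le_trans _ _ (\sum_(k | (A %| n k)%N) (t + A%:R / (n k)%:R))).
  apply: ler_sum => k _; rewrite /weight /t mulrDr.
  have : 0 <= A%:R / (n k)%:R :> rat by rewrite divr_ge0 ?ler0n.
  move=> ge0; have [_|_] := leP 1 (A%:R / N%:R : rat).
    by rewrite ge_min lerDl ge0.
  by rewrite ge_min lexx orbT.
rewrite big_split /= sumr_const -[X in X + _]mulr_natl.
have -> : 4 * D%:R = 2 * D%:R + 2 * D%:R :> rat by ring.
apply: lerD (sum_inv_dvd A_gt0).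
apply: le_trans (_ : 2 <= _); last by rewrite ler_peMr // ler1n.
have le_card : #|[pred k | (A %| n k)%N]|%:R <= N%:R / A%:R + 1 :> rat.
  apply: le_trans (_ : (N %/ A).+1%:R <= _).
    by rewrite ler_nat -cardsE card_dvd.
  rewrite -natr1 lerD2r ler_pdivlMr ?ltr0n // -natrM ler_nat.
  exact: leq_trunc_div.
apply: le_trans (ler_wpM2r t_ge0 le_card) _; rewrite mulrDl mul1r.
have A0 : A%:R != 0 :> rat by rewrite pnatr_eq0 -lt0n.
have N0 : N%:R != 0 :> rat by rewrite pnatr_eq0 -lt0n.
have -> : 2 = 1 + 1 :> rat by ring.
apply: lerD; last by rewrite ge_min lexx.
apply: (@le_trans _ _ (N%:R / A%:R * (A%:R / N%:R))).
  by rewrite ler_wpM2l ?divr_ge0 ?ler0n // ge_min lexx orbT.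
by rewrite le_eqVlt; apply/orP; left; apply/eqP; field; rewrite A0 N0.
Qed.

(** The gcd is one of the at most [D] divisors of [P]; summing over all of them reduces to a fixed
    [A]. *)
Let sum_weight P : (0 < P <= M ^ 5)%N ->
  \sum_k weight (gcdn (n k) P) (n k) <= 4 * D%:R ^+ 2.
Proof.
move=> P_bd; have /andP[P_gt0 _] := P_bd.
have le_k k : weight (gcdn (n k) P) (n k) <=
    \sum_(A <- divisors P) (if (A %| n k)%N then weight A (n k) else 0).
  rewrite (bigD1_seq (gcdn (n k) P)) ?divisors_uniq //=; last first.
    by rewrite -dvdn_divisors // dvdn_gcdr.
  rewrite dvdn_gcdl lerDl sumr_ge0 // => A _.
  by case: ifP.
apply: le_trans (ler_sum _ (fun k _ => le_k k)) _.
rewrite exchange_big /= expr2 mulrA.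
apply: (@le_trans _ _ (\sum_(A <- divisors P) 4 * D%:R)).
  rewrite big_seq [leRHS]big_seq; apply: ler_sum => A.
  rewrite -dvdn_divisors // => AP; rewrite -big_mkcond /=.
  by apply: sum_weight_dvd; apply: dvdn_gt0 AP.
rewrite big_const_seq count_predT iter_addr_0 -[leLHS]mulr_natr.
by rewrite ler_wpM2l ?mulr_ge0 // ler_nat D_bound.
Qed.

(** Indices are chosen one after the other, [P] being the product of the earlier [n k]; it stays
    fixed in each inner sum. *)
Let nested_sum := fix S j P : rat :=
  if j is i.+1 then \sum_k weight (gcdn (n k) P) (n k) * S i (P * n k)%N else 1.

Let nested_sumS c j P : c * nested_sum j.+1 P =
  \sum_k c * weight (gcdn (n k) P) (n k) * nested_sum j (P * n k)%N.
Proof. by rewrite mulr_sumr; apply: eq_bigr => k _; rewrite mulrA. Qed.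

(** The condition on [P] allows for the [6 - j] indices already chosen, so that [P <= M ^ 5]
    whenever [sum_weight] is applied. *)
Let nested_sum_le j P : (j <= 6)%N -> (0 < P <= M ^ (6 - j))%N ->
  nested_sum j P <= (4 * D%:R ^+ 2) ^+ j.
Proof.
elim: j P => [|j IHj] P le_j P_bd; first by rewrite lexx.
have /andP[P_gt0 P_le] := P_bd; rewrite /= exprS.
apply: (@le_trans _ _ (\sum_k weight (gcdn (n k) P) (n k) * (4 * D%:R ^+ 2) ^+ j)).
  apply: ler_sum => k _; rewrite ler_wpM2l // IHj ?(ltnW le_j) //.
  have /andP[n_gt0 n_le] := n_bound k.
  rewrite muln_gt0 P_gt0 n_gt0 /= -subSS subSn // expnSr leq_mul //.
rewrite -mulr_suml ler_wpM2r ?exprn_ge0 ?mulr_ge0 ?exprn_ge0 ?ler0n //.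
apply: sum_weight; rewrite P_gt0 (leq_trans P_le) // leq_pexp2l //.
lia.
Qed.

Let weight_pair k P S : (0 < P)%N -> (0 < S)%N -> (n k %| P * S)%N ->
  N%:R^-1 <= weight (gcdn (n k) P) (n k) * weight (gcdn (n k) S) (n k).
Proof.
move=> P_gt0 S_gt0 kPS; have /andP[n_gt0 _] := n_bound k.
apply: weight_mul; rewrite ?gcdn_gt0 ?n_gt0 //.
by apply: dvdn_leq (dvdn_mul_gcd kPS); rewrite muln_gt0 !gcdn_gt0 n_gt0.
Qed.

Let T6 := ('I_N * 'I_N * 'I_N * 'I_N * 'I_N * 'I_N)%type.

Let W (z : T6) : rat := let: (a, b, c, d, e, f) := z in
  1 * weight (gcdn (n a) 1) (n a)
    * weight (gcdn (n b) (1 * n a)) (n b)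
    * weight (gcdn (n c) (1 * n a * n b)) (n c)
    * weight (gcdn (n d) (1 * n a * n b * n c)) (n d)
    * weight (gcdn (n e) (1 * n a * n b * n c * n d)) (n e)
    * weight (gcdn (n f) (1 * n a * n b * n c * n d * n e)) (n f).

Let sum_W : \sum_z W z <= (4 * D%:R ^+ 2) ^+ 6.
Proof.
apply: le_trans (nested_sum_le (j := 6) (P := 1) _ _) => //.
rewrite -[leRHS]mul1r le_eqVlt; apply/orP; left; apply/eqP.
rewrite !sum_pairE nested_sumS; apply: eq_bigr => a _.
rewrite nested_sumS; apply: eq_bigr => b _.
rewrite nested_sumS; apply: eq_bigr => c _.
rewrite nested_sumS; apply: eq_bigr => d _.
rewrite nested_sumS; apply: eq_bigr => e _.
by rewrite nested_sumS; apply: eq_bigr => f _; rewrite mulr1.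
Qed.

Let rev6 (z : T6) : T6 := let: (a, b, c, d, e, f) := z in (f, e, d, c, b, a).

Let solution (z : T6) := let: (a, b, c, d, e, f) := z in
  (y a)%:~R^-1 + (y b)%:~R^-1 + (y c)%:~R^-1 ==
  (y d)%:~R^-1 + (y e)%:~R^-1 + (y f)%:~R^-1 :> rat.

(* The weights of a solution and of its reversal multiply to at least [N^-6],
   so one of the two is at least [N^-3]. *)
Let solution_weight z : solution z -> 1 <= N%:R ^+ 3 * (W z + W (rev6 z)).
Proof.
case: z => [[[[[a b] c] d] e] f] /eqP eq_y.
have y0 k : y k != 0 by rewrite -absz_gt0; case/andP: (n_bound k).
have n0 k : (0 < n k)%N by case/andP: (n_bound k).
have sgn (s : bool) i : (if s then - (y i)%:~R^-1 else (y i)%:~R^-1) =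
    ((if s then - y i else y i)%:~R)^-1 :> rat.
  by case: s => //; rewrite rmorphN /= invrN.
have sgn0 (s : bool) i : (if s then - y i else y i) != 0.
  by case: s; rewrite ?oppr_eq0.
have abs_sgn (s : bool) i : `|if s then - y i else y i|%N = n i.
  by case: s; rewrite ?abszN.
(* Each of the six reciprocals is a signed sum of the other five; the booleans mark the terms that
   carry a minus sign. *)
have dvd_prod s1 s2 s3 s4 s5 k k1 k2 k3 k4 k5 l :
    (n k1 * n k2 * n k3 * n k4 * n k5)%N = l ->
    (y k)%:~R^-1 = (if s1 then - (y k1)%:~R^-1 else (y k1)%:~R^-1)
      + (if s2 then - (y k2)%:~R^-1 else (y k2)%:~R^-1)
      + (if s3 then - (y k3)%:~R^-1 else (y k3)%:~R^-1)
      + (if s4 then - (y k4)%:~R^-1 else (y k4)%:~R^-1)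
      + (if s5 then - (y k5)%:~R^-1 else (y k5)%:~R^-1) :> rat ->
    (n k %| l)%N.
  move=> <-; rewrite !sgn => /dvdz_inv_sum; rewrite !abs_sgn; apply=> //.
have W_mul : (N%:R^-1) ^+ 6 <= W (a, b, c, d, e, f) * W (f, e, d, c, b, a).
  pose pr k P S := weight (gcdn (n k) P) (n k) * weight (gcdn (n k) S) (n k).
  have -> : W (a, b, c, d, e, f) * W (f, e, d, c, b, a) =
      pr a 1%N (1 * n f * n e * n d * n c * n b)%N
      * pr b (1 * n a)%N (1 * n f * n e * n d * n c)%N
      * pr c (1 * n a * n b)%N (1 * n f * n e * n d)%N
      * pr d (1 * n a * n b * n c)%N (1 * n f * n e)%N
      * pr e (1 * n a * n b * n c * n d)%N (1 * n f)%N
      * pr f (1 * n a * n b * n c * n d * n e)%N 1%N.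
    by rewrite /W /pr; ring.
  have -> : (N%:R^-1 : rat) ^+ 6 = N%:R^-1 * N%:R^-1 * N%:R^-1 * N%:R^-1 * N%:R^-1 * N%:R^-1.
    by ring.
  have pr_ge k P S : (0 < P)%N -> (0 < S)%N -> (n k %| P * S)%N -> N%:R^-1 <= pr k P S.
    exact: weight_pair.
  have t_ge0 : 0 <= N%:R^-1 :> rat by rewrite invr_ge0 ler0n.
  apply: ler_pM; rewrite ?mulr_ge0 //; [apply: ler_pM; rewrite ?mulr_ge0 //; [
    apply: ler_pM; rewrite ?mulr_ge0 //; [apply: ler_pM; rewrite ?mulr_ge0 //; [
    apply: ler_pM; rewrite ?mulr_ge0 // |] |] |] |];
    apply: pr_ge; rewrite ?muln_gt0 ?n0 //.
  - by apply: (@dvd_prod true true false false false a b c d e f); [ring|lra].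
  - by apply: (@dvd_prod true true false false false b a c d e f); [ring|lra].
  - by apply: (@dvd_prod true true false false false c a b d e f); [ring|lra].
  - by apply: (@dvd_prod false false false true true d a b c e f); [ring|lra].
  - by apply: (@dvd_prod false false false true true e a b c d f); [ring|lra].
  - by apply: (@dvd_prod false false false true true f a b c d e); [ring|lra].
have W_ge0 z : 0 <= W z.
  by case: z => [[[[[? ?] ?] ?] ?] ?]; rewrite /W !mulr_ge0.
rewrite [rev6 _]/=; move: W_mul (W_ge0 (a, b, c, d, e, f)) (W_ge0 (f, e, d, c, b, a)).
move: (W _) (W _) => w1 w2 w12 w1_ge0 w2_ge0.
have N_pos : 0 < N%:R ^+ 3 :> rat by rewrite exprn_gt0 // ltr0n.
rewrite mulrC -ler_pdivrMr // mul1r -exprVn.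
have [//|lt] := lerP; rewrite ltNge in lt; case/negP: lt.
set t := N%:R^-1 ^+ 3 in w12 *; have t_ge0 : 0 <= t by rewrite exprn_ge0 // invr_ge0 ler0n.
have {}w12 : t * t <= w1 * w2 by rewrite [w1 * w2]mulrC; apply: le_trans w12; rewrite /t -exprD.
nra.
Qed.

(** Each solution contributes at least 1 to the sum of [N^3 (W z + W (rev6 z))], and [rev6] permutes
    the tuples, so [sum_W] bounds both halves. *)
Lemma card_reciprocal_solutions : (#|[pred z | solution z]| <= 2 * N ^ 3 * (4 * D ^ 2) ^ 6)%N.
Proof.
rewrite -(ler_nat rat) -sum1_card natr_sum.
apply: (@le_trans _ _ (\sum_z N%:R ^+ 3 * (W z + W (rev6 z)))).
  rewrite big_mkcond /=; apply: ler_sum => z _; case: ifP => [/solution_weight//|_].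
  rewrite mulr_ge0 ?exprn_ge0 ?ler0n // addr_ge0 //.
    by case: z => [[[[[? ?] ?] ?] ?] ?]; rewrite /W !mulr_ge0.
  by case: z => [[[[[? ?] ?] ?] ?] ?]; rewrite /W !mulr_ge0.
rewrite -mulr_sumr big_split /=.
have -> : \sum_z W (rev6 z) = \sum_z W z.
  rewrite [RHS](reindex_inj (inv_inj (f := rev6) _)) //.
  by case=> [[[[[? ?] ?] ?] ?] ?].
apply: (@le_trans _ _ (N%:R ^+ 3 * ((4 * D%:R ^+ 2) ^+ 6 + (4 * D%:R ^+ 2) ^+ 6))).
  by rewrite ler_wpM2l ?exprn_ge0 ?ler0n // lerD.
have natE (a b c : nat) : (2 * a ^ 3 * b ^ 6)%N%:R = 2 * a%:R ^+ 3 * b%:R ^+ 6 :> rat.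
  by rewrite natrM natrX natrM natrX.
have -> : 4 * D%:R ^+ 2 = (4 * D ^ 2)%N%:R :> rat by rewrite natrM natrX.
have double (s t : rat) : s * (t + t) = 2 * s * t by ring.
by rewrite double -natE.
Qed.

End ReciprocalSums.

(** * Sums of reciprocals modulo p *)

Lemma card_le_in (T U : finType) (f : T -> U) (A : {pred T}) (B : {pred U}) :
  {in A &, injective f} -> (forall x, x \in A -> f x \in B) -> (#|A| <= #|B|)%N.
Proof.
move=> f_inj fAB; rewrite [leqRHS]cardE; apply: card_le_size f_inj _ => x xA.
by rewrite mem_enum fAB.
Qed.

Lemma card_le_fibers (T : finType) (U : eqType) (f : T -> U) (A : {set T})
    (s : seq U) c :
  (forall x, x \in A -> f x \in s) ->
  (forall v, (#|[set x in A | f x == v]| <= c)%N) -> (#|A| <= c * size s)%N.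
Proof.
elim: s A => [|v s IHs] A As fib.
  by have [->|[x /As]] := set_0Vmem A; rewrite ?cards0.
rewrite -(cardsID [set x in A | f x == v] A) mulnS leq_add //.
  by rewrite (leq_trans _ (fib v)) // subset_leq_card // subsetIr.
apply: IHs => [x|w]; last first.
  apply: leq_trans (fib w); apply/subset_leq_card/subsetP => x.
  by rewrite !inE => /andP[/andP[_ ->] ->].
rewrite !inE negb_and => /andP[+ xA]; rewrite xA /= => neq.
by have := As x xA; rewrite inE (negPf neq).
Qed.

Definition zdivisors (m : int) : seq int :=
  [seq d%:Z | d <- divisors `|m|] ++ [seq - d%:Z | d <- divisors `|m|].

Lemma size_zdivisors m : size (zdivisors m) = (2 * size (divisors `|m|))%N.
Proof. by rewrite size_cat !size_map addnn mul2n. Qed.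

Lemma mem_zdivisors (d m : int) : m != 0 -> (d %| m)%Z -> d \in zdivisors m.
Proof.
rewrite -absz_gt0 => m_gt0; rewrite dvdzE dvdn_divisors // => d_m.
rewrite mem_cat; apply/orP.
case: (intP d) d_m => [|n|n] d_m; [left | left | right].
- by apply/mapP; exists 0%N.
- by apply/mapP; exists n.+1.
- by apply/mapP; exists n.+1; rewrite ?abszN in d_m *.
Qed.

Lemma norm_subM (x y z w X Y Z W : int) :
  `|x| <= X -> `|y| <= Y -> `|z| <= Z -> `|w| <= W ->
  `|x * y - z * w| <= X * Y + Z * W.
Proof.
move=> *; apply: le_trans (ler_normB _ _) _; rewrite !normrM.
by apply: lerD; apply: ler_pM.
Qed.

Lemma norm_mul3 (x y z X Y Z : int) :
  `|x| <= X -> `|y| <= Y -> `|z| <= Z -> `|x * y * z| <= X * Y * Z.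
Proof. by move=> *; rewrite !normrM; apply: ler_pM; rewrite ?mulr_ge0 //; apply: ler_pM. Qed.

Lemma norm_add3M (x y z x' y' z' X Y Z X' Y' Z' : int) :
  `|x| <= X -> `|y| <= Y -> `|z| <= Z -> `|x'| <= X' -> `|y'| <= Y' -> `|z'| <= Z' ->
  `|x * x' + y * y' + z * z'| <= X * X' + Y * Y' + Z * Z'.
Proof.
move=> *; apply: le_trans (ler_normD _ _) _; rewrite [`|z * _|]normrM.
apply: lerD; last exact: ler_pM.
apply: le_trans (ler_normD _ _) _; rewrite !normrM.
by apply: lerD; apply: ler_pM.
Qed.

(** The vector [w] is orthogonal to [d] and [e], hence proportional to their cross product; the
    relations avoid division. *)
Lemma cross_proportional (F : comNzRingType) (w1 w2 w3 : F) (d1 d2 d3 e1 e2 e3 : int) :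
  w1 * d1%:~R + w2 * d2%:~R + w3 * d3%:~R = 0 ->
  w1 * e1%:~R + w2 * e2%:~R + w3 * e3%:~R = 0 ->
  w3 * (d2 * e3 - d3 * e2)%:~R = w1 * (d1 * e2 - d2 * e1)%:~R /\
  w3 * (d3 * e1 - d1 * e3)%:~R = w2 * (d1 * e2 - d2 * e1)%:~R.
Proof.
rewrite !rmorphB !rmorphM /=.
move: (d1%:~R) (d2%:~R) (d3%:~R) (e1%:~R) (e2%:~R) (e3%:~R) => x1 x2 x3 y1 y2 y3 eq_d eq_e.
split; apply/eqP; rewrite eq_sym -subr_eq0; apply/eqP.
  transitivity (y2 * (w1 * x1 + w2 * x2 + w3 * x3) - x2 * (w1 * y1 + w2 * y2 + w3 * y3)).
    by ring.
  by rewrite eq_d eq_e !mulr0 subrr.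
transitivity (x1 * (w1 * y1 + w2 * y2 + w3 * y3) - y1 * (w1 * x1 + w2 * x2 + w3 * x3)).
  by ring.
by rewrite eq_d eq_e !mulr0 subrr.
Qed.

(* [A Z^3 + 3 B Z^2 + 3 C Z + D] with vanishing discriminant has the double root
   [- alpha] read off its Hessian; the conclusions say that [- alpha] is a root of
   the two partial derivatives of its homogenization. *)
Lemma double_root_hessian (K : fieldType) (A B C D alpha : K) :
    2%:R != 0 :> K -> B ^+ 2 - A * C != 0 ->
    (B * C - A * D) ^+ 2 = 4 * (B ^+ 2 - A * C) * (C ^+ 2 - B * D) ->
    alpha = (B * C - A * D) / (2 * (B ^+ 2 - A * C)) ->
  A * alpha ^+ 2 - 2 * B * alpha + C = 0 /\ B * alpha ^+ 2 - 2 * C * alpha + D = 0.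
Proof.
move=> two_neq0 h0_neq0 disc ->.
have [h0 h0E] : exists h0, h0 = B ^+ 2 - A * C by eexists.
have [h1 h1E] : exists h1, h1 = B * C - A * D by eexists.
have [h2 h2E] : exists h2, h2 = C ^+ 2 - B * D by eexists.
rewrite -h0E -h1E -h2E in disc h0_neq0 *.
have four_neq0 : 4 != 0 :> K by rewrite (_ : 4 = 2 * 2 :> K) ?mulf_neq0 //; ring.
(* Up to sign, [(h2, - h1, h0)] is the cross product of [(A, B, C)] and [(B, C, D)], and
   [h1 ^+ 2 = 4 * h0 * h2] makes it [h0] times [(alpha^2, - 2 alpha, 1)]. *)
have sol (a b c : K) : a * h2 - b * h1 + c * h0 = 0 ->
    a * (h1 / (2 * h0)) ^+ 2 - 2 * b * (h1 / (2 * h0)) + c = 0.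
  move=> eq0; transitivity ((a * h1 ^+ 2 - 4 * b * h1 * h0 + 4 * c * h0 ^+ 2) / (4 * h0 ^+ 2)).
    by field; rewrite h0_neq0 four_neq0 two_neq0.
  rewrite disc (_ : _ + _ = 4 * h0 * (a * h2 - b * h1 + c * h0)); last by ring.
  by rewrite eq0 mulr0 mul0r.
by split; apply: sol; rewrite h0E h1E h2E; ring.
Qed.

(** Expand the plane equation in [alpha + x], [alpha + y], [alpha + z]: the double root kills the
    terms of degree one and zero, leaving a proportionality between the third and second elementary
    symmetric functions. *)
Lemma sum_inv_degenerate (K : fieldType) (A B C D alpha x y z : K) :
    A != 0 -> A * alpha ^+ 2 - 2 * B * alpha + C = 0 ->
    B * alpha ^+ 2 - 2 * C * alpha + D = 0 ->
    C * (x + y + z) + B * (x * y + x * z + y * z) + A * (x * y * z) + D = 0 ->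
    alpha + x != 0 -> alpha + y != 0 -> alpha + z != 0 ->
  (alpha + x)^-1 + (alpha + y)^-1 + (alpha + z)^-1 = A / (A * alpha - B).
Proof.
move=> A_neq0 eqC eqD eq0 x0 y0 z0.
have key : A * ((alpha + x) * (alpha + y) * (alpha + z)) = (A * alpha - B) *
    ((alpha + x) * (alpha + y) + (alpha + x) * (alpha + z) + (alpha + y) * (alpha + z)).
  apply/eqP; rewrite -subr_eq0; apply/eqP.
  transitivity (C * (x + y + z) + B * (x * y + x * z + y * z) + A * (x * y * z) + D
    - (A * alpha ^+ 2 - 2 * B * alpha + C) * (x + y + z + 2 * alpha)
    - (B * alpha ^+ 2 - 2 * C * alpha + D)); first by ring.
  by rewrite eq0 eqC eqD mul0r !subr0.
have G_neq0 : A * alpha - B != 0.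
  apply/negP => /eqP G0; move: key; rewrite G0 mul0r => /eqP.
  by rewrite !mulf_eq0 (negPf A_neq0) (negPf x0) (negPf y0) (negPf z0).
apply: (mulfI G_neq0).
apply: (mulfI (mulf_neq0 (mulf_neq0 x0 y0) z0)).
transitivity ((A * alpha - B) *
    ((alpha + x) * (alpha + y) + (alpha + x) * (alpha + z) + (alpha + y) * (alpha + z))).
  by field; rewrite x0 y0 z0.
by rewrite -key; field.
Qed.

(** * Pairs in a common fiber, and Cauchy-Schwarz *)

Definition fiber_pairs (X : finType) (U : eqType) (f : X -> U) (A : {set X}) : {set X * X} :=
  [set z | [&& z.1 \in A, z.2 \in A & f z.1 == f z.2]].

Lemma card_fiber_pairs (X Y : finType) (f : X -> Y) (A : {set X}) :
  (#|fiber_pairs f A| = \sum_y #|[set x in A | f x == y]| ^ 2)%N.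
Proof.
rewrite -sum1_card (partition_big (fun z : X * X => f z.1) predT) //=.
apply: eq_bigr => y _; rewrite sum1dep_card expnS expn1 -cardsX.
apply: eq_card => z; rewrite !inE.
case: (z.1 \in A); case: (z.2 \in A); rewrite ?andbF //= andbC.
by case: (f z.1 =P y) => //= ->; rewrite eq_sym.
Qed.

(** Cauchy-Schwarz for the fiber sizes, by summing [2 r(y) r(z) <= r(y)^2 + r(z)^2] over all pairs
    of values. *)
Lemma card_sq_le_fiber_pairs (X Y : finType) (f : X -> Y) (A : {set X}) :
  (#|A| ^ 2 <= #|f @: A| * #|fiber_pairs f A|)%N.
Proof.
rewrite card_fiber_pairs; pose r y := #|[set x in A | f x == y]|.
have -> : (#|A| = \sum_(y in f @: A) r y)%N.
  rewrite -sum1_card (partition_big f (mem (f @: A))) => [|x xA]; last exact: imset_f.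
  by apply: eq_bigr => y _; rewrite sum1dep_card /r; apply: eq_card => x; rewrite !inE.
apply: (@leq_trans (#|f @: A| * \sum_(y in f @: A) r y ^ 2)); last first.
  by rewrite leq_mul2l [X in (_ <= X)%N](bigID (mem (f @: A))) /= leq_addr orbT.
rewrite -(leq_pmul2l (isT : 0 < 2)%N) expnS expn1 big_distrl big_distrr /=.
apply: (@leq_trans (\sum_(y in f @: A) \sum_(z in f @: A) (r y ^ 2 + r z ^ 2))).
  apply: leq_sum => y _; rewrite big_distrr big_distrr /=; apply: leq_sum => z _.
  exact: nat_Cauchy.
under eq_bigr do rewrite big_split sum_nat_const /=.
by rewrite big_split sum_nat_const /= -big_distrr /= mul2n addnn.
Qed.

(** Cauchy-Schwarz inside each fiber of [f], which [g] cuts into at most [#|Z|] pieces. *)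
Lemma card_fiber_pairs_refine (X Y Z : finType) (f : X -> Y) (g : X -> Z) (A : {set X}) :
  (#|fiber_pairs f A| <= #|Z| * #|fiber_pairs (fun x => (f x, g x)) A|)%N.
Proof.
rewrite card_fiber_pairs -[#|fiber_pairs (fun x => (f x, g x)) A|]sum1_card.
rewrite (partition_big (fun z : X * X => f z.1) predT) //= big_distrr /=.
apply: leq_sum => y _; rewrite sum1dep_card.
apply: leq_trans (card_sq_le_fiber_pairs g _) _.
apply: leq_mul; first exact: max_card.
apply/subset_leq_card/subsetP => z; rewrite !inE xpair_eqE.
by move=> /and3P[/andP[-> /eqP ->] /andP[-> /eqP ->] ->]; rewrite !eqxx.
Qed.

Section Modular.

Variables (F : finFieldType) (p N D : nat) (a : F).
Hypotheses (N_gt1 : (1 < N)%N) (N_lt : (N ^ 18 < p)%N).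
Hypothesis small : forall z : int, `|z| < p%:Z -> z%:~R = 0 :> F -> z = 0.
Hypothesis D_bound : forall m, (0 < m <= N ^ 45)%N -> (size (divisors m) <= D)%N.
Hypothesis a_neq0 : forall k : 'I_N, a + (k%:Z)%:~R != 0.

Let D_gt0 : (0 < D)%N.
Proof. by apply: leq_trans (D_bound (m := 1%N) _); rewrite // expn_gt0 (ltnW N_gt1). Qed.

Let n : int := N%:Z.

Let n_ge2 : 2 <= n. Proof. by rewrite /n; lia. Qed.

Let n18_lt : n ^+ 18 < p%:Z.
Proof. by rewrite /n -!natz -natrX ltr_nat. Qed.

Let pow_le i j : (i <= j)%N -> n ^+ i <= n ^+ j.
Proof. by move=> le_ij; rewrite ler_weXn2l //; lia. Qed.

(** As [n >= 2], a constant [2 ^+ c] costs at most [c] further powers of [n], and [n ^+ 18 < p]. *)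
Let small_pow z (i c : nat) : (c + i <= 18)%N -> `|z| <= 2 ^+ c * n ^+ i ->
  z%:~R = 0 :> F -> z = 0.
Proof.
move=> le_c z_le; apply: small; apply: le_lt_trans n18_lt.
apply: le_trans z_le _; apply: le_trans (pow_le le_c).
rewrite exprD ler_wpM2r ?exprn_ge0 ?lerXn2r ?nnegrE //; lia.
Qed.

Let absz_le_pow (z : int) i : (i <= 45)%N -> `|z| <= n ^+ i -> (`|z| <= N ^ 45)%N.
Proof.
move=> /pow_le le_i /le_trans/(_ le_i); rewrite -abszE -lez_nat /n -!natz natrX.
by rewrite !natz.
Qed.

Let rec (k : 'I_N) : F := (a + (k%:Z)%:~R)^-1.

Let rec_inj : injective rec.
Proof.
move=> i j /invr_inj /addrI /eqP; rewrite -subr_eq0 -rmorphB /= => /eqP.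
move/(@small_pow _ 1 0 isT); have := ltn_ord i; have := ltn_ord j.
rewrite expr0 expr1 mul1r /n => lt_j lt_i eq_ij; apply: val_inj => /=.
suff: (i%:Z - j%:Z = 0) by lia.
by apply: eq_ij; lia.
Qed.

Let ord_int (k : 'I_N) : 0 <= k%:Z < n.
Proof. by have := ltn_ord k; rewrite /n; lia. Qed.

Let ord_sub (k l : 'I_N) : `|k%:Z - l%:Z| <= n.
Proof. by have := ord_int k; have := ord_int l; lia. Qed.

(** * Two reciprocals with a given non-zero sum *)

Section Pairs.

Variable mu : F.
Hypothesis mu_neq0 : mu != 0.

Let S := [set w : 'I_N * 'I_N | rec w.1 + rec w.2 == mu].

Let e1 (w : 'I_N * 'I_N) : int := w.1%:Z + w.2%:Z.
Let e2 (w : 'I_N * 'I_N) : int := w.1%:Z * w.2%:Z.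

Let S_eq w : w \in S -> mu * a ^+ 2 - 2 * a + (mu * a - 1) * (e1 w)%:~R + mu * (e2 w)%:~R = 0.
Proof.
rewrite inE => /eqP <-; rewrite /e1 /e2 rmorphM rmorphD /= /rec.
move: (a_neq0 w.1) (a_neq0 w.2); move: (_%:~R) (_%:~R) => x y *; field.
by apply/andP.
Qed.

Let e1_le w w' : `|e1 w - e1 w'| <= 2 * n.
Proof.
have := ord_int w.1; have := ord_int w.2; have := ord_int w'.1; have := ord_int w'.2.
rewrite /e1; lia.
Qed.

Let e2_le w w' : `|e2 w - e2 w'| <= n ^+ 2.
Proof.
have := ord_int w.1; have := ord_int w.2; have := ord_int w'.1; have := ord_int w'.2.
rewrite /e2; nia.
Qed.

Let S_diff w w' : w \in S -> w' \in S ->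
  (mu * a - 1) * (e1 w - e1 w')%:~R + mu * (e2 w - e2 w')%:~R = 0.
Proof.
move=> /S_eq eq_w /S_eq eq_w'; rewrite !rmorphB /=.
by have := congr2 (fun s t => s - t) eq_w eq_w'; rewrite subrr => <-; ring.
Qed.

Let S_e1 w w' : w \in S -> w' \in S -> e1 w = e1 w' -> e2 w = e2 w'.
Proof.
move=> wS w'S eq_e; have := S_diff wS w'S.
rewrite eq_e subrr mulr0 add0r => /eqP; rewrite mulf_eq0 (negPf mu_neq0) /= => /eqP.
move/(@small_pow _ 2 0 isT) => /(_ _)/eqP; rewrite subr_eq0 => h; apply/eqP/h.
by rewrite mul1r e2_le.
Qed.

(** Both difference vectors are orthogonal to [(mu a - 1, mu)] with [mu] invertible, so their
    determinant vanishes in [F]; being at most [4 n^3] in size, it vanishes over the integers. *)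
Let S_det w0 w1 w : w0 \in S -> w1 \in S -> w \in S ->
  (e1 w1 - e1 w0) * (e2 w - e2 w0) = (e2 w1 - e2 w0) * (e1 w - e1 w0).
Proof.
move=> w0S w1S wS; apply/eqP; rewrite -subr_eq0; apply/eqP.
apply: (@small_pow _ 3 2 isT).
  have le1 := e1_le w1 w0; have le2 := e2_le w w0.
  have le3 := e1_le w w0; have le4 := e2_le w1 w0.
  apply: le_trans (norm_subM le1 le2 le4 le3) _.
  rewrite le_eqVlt; apply/orP; left; apply/eqP; ring.
apply: (mulfI mu_neq0); rewrite mulr0 rmorphB !rmorphM /=.
have det0 (c d1 d2 d3 d4 : F) :
    c * d1 + mu * d2 = 0 -> c * d3 + mu * d4 = 0 -> mu * (d1 * d4 - d2 * d3) = 0.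
  move=> eq1 eq2; transitivity (d1 * (c * d3 + mu * d4) - d3 * (c * d1 + mu * d2)).
    by ring.
  by rewrite eq1 eq2 !mulr0 subrr.
exact: det0 (S_diff w1S w0S) (S_diff wS w0S).
Qed.

Let S_inj w w' : w \in S -> w' \in S -> w.1 = w'.1 -> w = w'.
Proof.
case: w w' => x y [x' y']; rewrite !inE => /= /eqP <- /eqP + eq_x.
by rewrite eq_x => /addrI /rec_inj ->.
Qed.

Let S_mem w w' : w \in S -> w' \in S -> e1 w = e1 w' -> w.1 \in [:: w'.1; w'.2].
Proof.
move=> wS w'S eq1; have eq2 := S_e1 wS w'S eq1.
rewrite !inE -!val_eqE /=; move: eq1 eq2; rewrite /e1 /e2 => eq1 eq2.
have : (w.1%:Z - w'.1%:Z) * (w.1%:Z - w'.2%:Z) = 0.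
  transitivity (w'.1%:Z * w'.2%:Z - w.1%:Z * w.2%:Z
    + w.1%:Z * (w.1%:Z + w.2%:Z - (w'.1%:Z + w'.2%:Z))); first by ring.
  by rewrite eq1 eq2 !subrr mulr0.
by move/eqP; rewrite mulf_eq0 !subr_eq0 !eqz_nat.
Qed.

(** If [e1] is constant on [S], all pairs come from the roots of one quadratic. Otherwise the points
    [(e1, e2)] lie on a line, and [Q w.1] divides a fixed non-zero resultant. *)
Lemma card_reciprocal_pairs : (#|S| <= 4 * D)%N.
Proof.
have [->|[w0 w0S]] := set_0Vmem S; first by rewrite cards0.
have [w1 /andP[w1S neq1]|all_eq] := pickP [pred w | (w \in S) && (e1 w != e1 w0)];
    last first.
  have eq1 w : w \in S -> e1 w = e1 w0.
    by move=> wS; have := all_eq w; rewrite /= wS => /negbFE/eqP.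
  apply: leq_trans (_ : 2 <= _)%N; last by move: D_gt0; lia.
  apply: (@card_le_size _ _ fst _ [:: w0.1; w0.2]) => [w w' wS w'S|w wS].
    exact: S_inj.
  by apply: S_mem => //; apply: eq1.
pose d1 := e1 w1 - e1 w0; pose d2 := e2 w1 - e2 w0.
have d1_neq0 : d1 != 0 by rewrite subr_eq0.
(* [Q] is the difference of the monic quadratics with roots [w1] and [w0], and [R] is their
   resultant: a zero would be a common root and force [e1 w1 = e1 w0]. *)
pose Q (k : 'I_N) := d2 - d1 * k%:Z.
pose R := Q w0.1 * Q w0.2.
have Q0 k : k = w0.1 \/ k = w0.2 -> Q k = (k%:Z - w1.1%:Z) * (k%:Z - w1.2%:Z).
  by case=> ->; rewrite /Q /d1 /d2 /e1 /e2; ring.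
have neq_pt k : k = w0.1 \/ k = w0.2 -> Q k != 0.
  move=> k0; rewrite Q0 // mulf_eq0 !subr_eq0 !eqz_nat !val_eqE.
  have : rec w0.1 + rec w0.2 = rec w1.1 + rec w1.2.
    by move: w0S w1S; rewrite !inE => /eqP -> /eqP ->.
  move=> sum_eq; apply/negP => eq_k; case/negP: neq1; apply/eqP; rewrite /e1.
  case: k0 eq_k sum_eq => -> /orP[] /eqP ->.
  - by move/addrI/rec_inj ->.
  - by rewrite [RHS]addrC => /addrI/rec_inj ->; rewrite addrC.
  - by rewrite addrC => /addrI/rec_inj ->; rewrite addrC.
  - by move/addIr/rec_inj ->.
have R_neq0 : R != 0 by rewrite mulf_neq0 // neq_pt; auto.
apply: leq_trans (_ : size (zdivisors R) <= _)%N.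
  apply: (@card_le_size _ _ (fun w => Q w.1)) => [w w' wS w'S|w wS].
    by move/addrI/oppr_inj/(mulfI d1_neq0) => -[] /val_inj; apply: S_inj.
  apply: mem_zdivisors => //; apply/dvdzP; exists (Q w.2).
  have := S_det w0S w1S wS; rewrite -/d1 -/d2 => det.
  apply/eqP; rewrite -subr_eq0 -(mulr0 d1) /R /Q; apply/eqP.
  transitivity (d1 * (d2 * (e1 w - e1 w0) - d1 * (e2 w - e2 w0))).
    by rewrite /e1 /e2; ring.
  by rewrite det subrr.
rewrite size_zdivisors; apply: (@leq_trans (2 * D)); last by rewrite leq_mul2r orbT.
rewrite leq_mul2l D_bound // absz_gt0 R_neq0 /= (@absz_le_pow _ 4) // normrM.
have Q_le k : k = w0.1 \/ k = w0.2 -> `|Q k| <= n * n.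
  move=> k0; rewrite Q0 // normrM; have := ord_int k.
  have := ord_int w1.1; have := ord_int w1.2 => *.
  by apply: ler_pM => //; lia.
rewrite (_ : n ^+ 4 = n * n * (n * n)); last by ring.
by apply: ler_pM; rewrite ?normr_ge0 ?Q_le //; auto.
Qed.

End Pairs.

Local Notation T3 := ('I_N * 'I_N * 'I_N)%type.

Let L (t : T3) : F := rec t.1.1 + rec t.1.2 + rec t.2.

(** Fix the last coordinate [z]: the other two form a pair with sum [lam - rec z], which is zero for
    at most one [z]; that [z] costs at most [N]. *)
Lemma card_triples lam : (#|[set t | L t == lam]| <= 5 * D * N)%N.
Proof.
have card_pairs0 : (#|[set w : 'I_N * 'I_N | (rec w.1 + rec w.2 == 0)%R]| <= N)%N.
  rewrite -[X in (_ <= X)%N]card_ord; apply: (card_le_in (f := fst)) => // w w'.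
  case: w w' => x y [x' y']; rewrite !inE /= => /eqP eq0 /eqP eq0' eq_x.
  by move: eq0'; rewrite -eq_x -eq0 => /addrI/rec_inj ->.
have card_z z : (#|[set t | L t == lam & t.2 == z]| <= 4 * D + N * (rec z == lam))%N.
  apply: (@leq_trans #|[set w : 'I_N * 'I_N | (rec w.1 + rec w.2 == lam - rec z)%R]|).
    apply: (card_le_in (f := fst)) => [[w x] [w' x']|[w x]]; rewrite !inE /=.
      by move=> /andP[_ /eqP ->] /andP[_ /eqP ->] ->.
    by move=> /andP[/eqP <- /eqP <-]; rewrite /L /= addrK.
  have [eq_z|neq_z] := eqVneq (rec z) lam.
    by rewrite eq_z subrr muln1 (leq_trans card_pairs0) // leq_addl.
  by rewrite muln0 addn0 card_reciprocal_pairs // subr_eq0 eq_sym.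
have -> : #|[set t | L t == lam]| = (\sum_z #|[set t | L t == lam & t.2 == z]|)%N.
  rewrite -sum1_card (partition_big (fun t : T3 => t.2) predT) //=.
  by apply: eq_bigr => z _; rewrite -sum1_card; apply: eq_bigl => t; rewrite !inE.
apply: (@leq_trans (\sum_z (4 * D + N * (rec z == lam)))%N).
  by apply: leq_sum => z _; apply: card_z.
rewrite big_split /= sum_nat_const card_ord -big_distrr /=.
have : (\sum_z (rec z == lam) <= 1)%N.
  have -> : (\sum_z (rec z == lam) = #|[set z | rec z == lam]|)%N.
    rewrite -sum1_card [RHS]big_mkcond; apply: eq_bigr => z _.
    by rewrite inE; case: (_ == _).
  rewrite leqNgt; apply/negP => /card_gt1P[x [y [+ + /eqP]]].
  by rewrite !inE => /eqP <- /eqP /rec_inj <-.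
move: (\sum_z _)%N D_gt0 => m D0 m1; rewrite mulnC.
apply: (@leq_trans (4 * D * N + N * 1)); first by rewrite leq_add2l leq_mul2l m1 orbT.
nia.
Qed.

Let s1 (t : T3) : int := t.1.1%:Z + t.1.2%:Z + t.2%:Z.
Let s2 (t : T3) : int := t.1.1%:Z * t.1.2%:Z + t.1.1%:Z * t.2%:Z + t.1.2%:Z * t.2%:Z.
Let s3 (t : T3) : int := t.1.1%:Z * t.1.2%:Z * t.2%:Z.

Let s_range t : [/\ 0 <= s1 t <= 3 * n, 0 <= s2 t <= 3 * n ^+ 2 & 0 <= s3 t <= n ^+ 3].
Proof.
rewrite /s1 /s2 /s3; move: (ord_int t.1.1) (ord_int t.1.2) (ord_int t.2).
move: (Posz _) (Posz _) (Posz _) => x y z /andP[x0 x1] /andP[y0 y1] /andP[z0 z1].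
have xy : 0 <= x * y <= n ^+ 2 by nia.
have xz : 0 <= x * z <= n ^+ 2 by nia.
have yz : 0 <= y * z <= n ^+ 2 by nia.
split; [lia | lia | ].
apply/andP; split; first by rewrite !mulr_ge0.
by rewrite exprSr; case/andP: xy => xy0 xy1; apply: ler_pM => //; lia.
Qed.

(** * The triples of one fiber: collinear and planar configurations *)

Section Class.

Variables (lam : F) (V : {set T3}).
Hypotheses (lam_neq0 : lam != 0) (lam_rec : forall k, lam != rec k).
Hypothesis VL : forall t, t \in V -> L t = lam.

Let V_eq t : t \in V ->
  lam * a ^+ 3 - 3 * a ^+ 2 + (lam * a ^+ 2 - 2 * a) * (s1 t)%:~R
    + (lam * a - 1) * (s2 t)%:~R + lam * (s3 t)%:~R = 0.
Proof.
move=> /VL <-; rewrite /s1 /s2 /s3 !(rmorphM, rmorphD) /= /L /rec.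
move: (a_neq0 t.1.1) (a_neq0 t.1.2) (a_neq0 t.2).
move: (_%:~R) (_%:~R) (_%:~R) => x y z hx hy hz; field.
by rewrite hx hy hz.
Qed.

Let V_diff t t' : t \in V -> t' \in V ->
  (lam * a ^+ 2 - 2 * a) * (s1 t - s1 t')%:~R
    + (lam * a - 1) * (s2 t - s2 t')%:~R + lam * (s3 t - s3 t')%:~R = 0.
Proof.
move=> /V_eq eq_t /V_eq eq_t'; rewrite !rmorphB /=.
by have := congr2 (fun x y => x - y) eq_t eq_t'; rewrite subrr => <-; ring.
Qed.

Let g (t : T3) (z : int) := (z - t.1.1%:Z) * (z - t.1.2%:Z) * (z - t.2%:Z).

Let gE t z : g t z = z ^+ 3 - s1 t * z ^+ 2 + s2 t * z - s3 t.
Proof. by rewrite /g /s1 /s2 /s3; ring. Qed.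

Let g_eq0 t (k : 'I_N) : (g t k == 0) = [|| k == t.1.1, k == t.1.2 | k == t.2].
Proof. by rewrite !mulf_eq0 !subr_eq0 !eqz_nat !val_eqE orbA. Qed.

Let card_V_sub (X : {set 'I_N}) :
  (forall t, t \in V -> [/\ t.1.1 \in X, t.1.2 \in X & t.2 \in X]) ->
  (#|V| <= #|X| ^ 3)%N.
Proof.
move=> VX; have -> : (#|X| ^ 3 = #|setX (setX X X) X|)%N by rewrite !cardsX !expnSr mul1n.
by apply/subset_leq_card/subsetP => t /VX[h1 h2 h3]; rewrite !inE h1 h2 h3.
Qed.

(** The cubics [g t] form a pencil spanned by [g t0] and [Q = g t1 - g t0]. Either these two share a
    root, which then lies in every triple, or each [Q] of an entry divides their non-zero resultant
    [R]. *)
Lemma card_collinear :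
  {in V & &, forall t0 t1 t,
    [/\ (s1 t1 - s1 t0) * (s2 t - s2 t0) = (s2 t1 - s2 t0) * (s1 t - s1 t0),
        (s1 t1 - s1 t0) * (s3 t - s3 t0) = (s3 t1 - s3 t0) * (s1 t - s1 t0) &
        (s2 t1 - s2 t0) * (s3 t - s3 t0) = (s3 t1 - s3 t0) * (s2 t - s2 t0)]} ->
  (#|V| <= 64 * D ^ 3)%N.
Proof.
move=> collinear.
have [->|[t0 t0V]] := set_0Vmem V; first by rewrite cards0.
have [t1 /andP[t1V neq1]|all_eq] :=
  pickP [pred t | (t \in V) && ((s1 t, s2 t, s3 t) != (s1 t0, s2 t0, s3 t0))]; last first.
  have eq_t t : t \in V -> [/\ s1 t = s1 t0, s2 t = s2 t0 & s3 t = s3 t0].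
    move=> tV; have := all_eq t; rewrite /= tV => /negbFE.
    by rewrite !xpair_eqE => /andP[/andP[/eqP e1 /eqP e2] /eqP e3].
  pose X := [set k | [|| k == t0.1.1, k == t0.1.2 | k == t0.2]].
  apply: (@leq_trans (#|X| ^ 3)); last first.
    have : (#|X| <= 3)%N.
      apply: (@card_le_size _ _ id _ [:: t0.1.1; t0.1.2; t0.2]) => // k.
      by rewrite !inE.
    move=> le3; apply: (@leq_trans (3 ^ 3)); first by rewrite leq_exp2r.
    by rewrite -[X in (X <= _)%N]muln1 leq_mul // expn_gt0 D_gt0.
  apply: card_V_sub => t /eq_t [e1 e2 e3].
  have mem (k : 'I_N) : g t k == 0 -> k \in X by rewrite gE e1 e2 e3 -gE g_eq0 inE.
  by split; apply: mem; rewrite g_eq0 eqxx ?orbT.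
pose d1 := s1 t1 - s1 t0; pose d2 := s2 t1 - s2 t0; pose d3 := s3 t1 - s3 t0.
have d12 : (d1 != 0) || (d2 != 0).
  rewrite -negb_and; apply: contra neq1 => /andP[/eqP d10 /eqP d20].
  have := V_diff t1V t0V; rewrite -/d1 -/d2 -/d3 d10 d20 !mulr0 !add0r => /eqP.
  rewrite mulf_eq0 (negPf lam_neq0) /= => /eqP /(@small_pow _ 3 0 isT) d30.
  have {}d30 : d3 = 0.
    apply: d30; rewrite mul1r /d3; have [_ _] := s_range t1.
    by have [_ _] := s_range t0; lia.
  by rewrite !xpair_eqE -(subr_eq0 (s1 _)) -(subr_eq0 (s2 _)) -(subr_eq0 (s3 _)) -/d1 -/d2 -/d3
    d10 d20 d30 eqxx.
pose Q (z : int) := - d1 * z ^+ 2 + d2 * z - d3.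
have Q_g z : Q z = g t1 z - g t0 z by rewrite !gE /Q /d1 /d2 /d3; ring.
have scale t : t \in V -> exists c m : int, c != 0 /\
    (forall z, c * (g t z - g t0 z) = m * Q z).
  move=> tV; have [e12 e13 e23] := collinear _ _ _ t0V t1V tV.
  have [d1_neq0|/negbNE/eqP d10] := boolP (d1 != 0).
    exists d1, (s1 t - s1 t0); split => // z; rewrite !gE /Q /d2 /d3.
    transitivity (- (d1 * (s1 t - s1 t0)) * z ^+ 2 + (d1 * (s2 t - s2 t0)) * z - d1 * (s3 t - s3 t0)).
      by ring.
    by rewrite e12 e13 /d1; ring.
  have d2_neq0 : d2 != 0 by move: d12; rewrite d10 eqxx.
  exists d2, (s2 t - s2 t0); split => // z; rewrite !gE /Q /d1 /d3.
  transitivity (- (d2 * (s1 t - s1 t0)) * z ^+ 2 + (d2 * (s2 t - s2 t0)) * z - d2 * (s3 t - s3 t0)).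
    by ring.
  by rewrite e23 -e12 /d2; ring.
pose R := Q t0.1.1 * Q t0.1.2 * Q t0.2.
(* A common root [q] occurs in each triple, in one of three positions; the other two entries have
   reciprocal sum [lam - rec q], non-zero by [lam_rec]. *)
have [R0|R_neq0] := eqVneq R 0.
  have [q Qq gq] : exists2 q : 'I_N, Q q = 0 & g t0 q = 0.
    move: R0 => /eqP; rewrite !mulf_eq0 -orbA => /or3P[] /eqP Q0;
      by [exists t0.1.1 => //; apply/eqP; rewrite g_eq0 eqxx ?orbT |
        exists t0.1.2 => //; apply/eqP; rewrite g_eq0 eqxx ?orbT |
        exists t0.2 => //; apply/eqP; rewrite g_eq0 eqxx ?orbT].
  have Vq t : t \in V -> [|| q == t.1.1, q == t.1.2 | q == t.2].
    move=> tV; have [c [m [c0 /(_ q)]]] := scale t tV.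
    by rewrite Qq gq subr0 mulr0 -g_eq0 => /eqP; rewrite mulf_eq0 (negPf c0).
  pose P := [set w : 'I_N * 'I_N | rec w.1 + rec w.2 == lam - rec q].
  have P_le : (#|P| <= 4 * D)%N by rewrite card_reciprocal_pairs // subr_eq0 lam_rec.
  apply: (@leq_trans (#|P| + #|P| + #|P|)%N); last first.
    apply: (@leq_trans (12 * D)); first lia.
    rewrite leq_mul // -[X in (X <= _)%N]expn1 leq_pexp2l //.
  pose V1 := [set t in V | t.1.1 == q]; pose V2 := [set t in V | t.1.2 == q].
  pose V3 := [set t in V | t.2 == q].
  apply: leq_trans (_ : #|V1 :|: V2 :|: V3| <= _)%N.
    apply/subset_leq_card/subsetP => t tV; rewrite !inE tV /= -orbA.
    by rewrite ![_ == q]eq_sym Vq.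
  apply: leq_trans (leq_card_setU _ _) _; apply: leq_add; last first.
    apply: (card_le_in (f := fst)) => [[w x] [w' x']|[w x]]; rewrite !inE /=.
      by move=> /andP[_ /eqP ->] /andP[_ /eqP ->] ->.
    by move=> /andP[/VL <- /eqP <-]; rewrite /L /= addrK.
  apply: leq_trans (leq_card_setU _ _) _; apply: leq_add.
    apply: (card_le_in (f := fun t : T3 => (t.1.2, t.2))) => [[[x y] z] [[x' y'] z']|[[x y] z]];
      rewrite !inE /=.
      by move=> /andP[_ /eqP ->] /andP[_ /eqP ->] [-> ->].
    by move=> /andP[/VL <- /eqP <-]; rewrite /L /=; apply/eqP; ring.
  apply: (card_le_in (f := fun t : T3 => (t.1.1, t.2))) => [[[x y] z] [[x' y'] z']|[[x y] z]];
    rewrite !inE /=.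
    by move=> /andP[_ /eqP ->] /andP[_ /eqP ->] [-> ->].
  by move=> /andP[/VL <- /eqP <-]; rewrite /L /=; apply/eqP; ring.
pose X := [set k : 'I_N | Q k \in zdivisors R].
have R_le : (`|R| <= N ^ 45)%N.
  rewrite (@absz_le_pow _ 9) //.
  have Q_le (k : 'I_N) : g t0 k = 0 -> `|Q k| <= n * n * n.
    move=> gk; rewrite Q_g gk subr0.
    by apply: norm_mul3; apply: ord_sub.
  rewrite (_ : n ^+ 9 = n * n * n * (n * n * n) * (n * n * n)); last by ring.
  by apply: norm_mul3; apply: Q_le;
    apply/eqP; rewrite g_eq0 eqxx ?orbT.
(* There are at most [2 * D] signed divisors of [R], and the non-constant polynomial [Q], of degree
   at most 2, takes each value at most twice. *)
have X_le : (#|X| <= 4 * D)%N.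
  apply: (@leq_trans (2 * size (zdivisors R))); last first.
    rewrite size_zdivisors mulnA leq_mul2l D_bound ?orbT // absz_gt0 R_neq0 //.
  apply: (card_le_fibers (f := fun k : 'I_N => Q k)) => [k|v]; first by rewrite inE.
  rewrite leqNgt; apply/negP => /card_gt2P [x [y [z [[]]]]].
  rewrite !inE => /andP[_ /eqP Qx] /andP[_ /eqP Qy] /andP[_ /eqP Qz] [xy yz zx].
  have quad (k l : 'I_N) : k != l -> Q k = v -> Q l = v -> d2 = d1 * (k%:Z + l%:Z).
    move=> kl Qk Ql; apply/eqP; rewrite -subr_eq0; apply/eqP.
    have kl0 : k%:Z - l%:Z != 0 by rewrite subr_eq0 eqz_nat val_eqE.
    apply: (mulfI kl0); rewrite mulr0.
    by transitivity (Q k - Q l); [rewrite /Q; ring | rewrite Qk Ql subrr].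
  have eq1 := quad _ _ xy Qx Qy; have eq2 := quad _ _ yz Qy Qz.
  have xz0 : x%:Z - z%:Z != 0 by rewrite subr_eq0 eqz_nat val_eqE eq_sym.
  have d10 : d1 = 0.
    apply: (mulIf xz0); rewrite mul0r.
    by transitivity (d1 * (x%:Z + y%:Z) - d1 * (y%:Z + z%:Z)); [ring | rewrite -eq1 -eq2 subrr].
  by move: d12; rewrite eq1 d10 mul0r eqxx.
apply: (@leq_trans (#|X| ^ 3)); last first.
  by rewrite (_ : 64 * D ^ 3 = (4 * D) ^ 3)%N ?leq_exp2r // expnMn.
apply: card_V_sub => t tV; have [c [m [c0 cm]]] := scale t tV.
suff dvdQ : [/\ (Q t.1.1 %| R)%Z, (Q t.1.2 %| R)%Z & (Q t.2 %| R)%Z].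
  by case: dvdQ => *; split; rewrite inE mem_zdivisors.
have [m0|m_neq0] := eqVneq m 0.
  have dvdQ (k : 'I_N) : g t k = 0 -> (Q k %| R)%Z.
    move=> gk; have /eqP := cm k; rewrite gk sub0r m0 mul0r mulf_eq0 (negPf c0) /=.
    rewrite oppr_eq0 g_eq0 => /or3P[] /eqP ->; rewrite /R.
    - by rewrite -mulrA dvdz_mulr.
    - by rewrite mulrAC dvdz_mull.
    - by rewrite dvdz_mull.
  by split; apply: dvdQ; apply/eqP; rewrite g_eq0 eqxx ?orbT.
(* Multiplied by [m ^+ 3], both sides become [c ^+ 3] times the product of the nine differences
   between entries of [t0] and entries of [t]. *)
suff -> : R = Q t.1.1 * Q t.1.2 * Q t.2.
  by split; [rewrite -mulrA dvdz_mulr | rewrite mulrAC dvdz_mull | rewrite dvdz_mull].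
have m3 : m ^+ 3 != 0 by rewrite expf_neq0.
apply: (mulfI m3).
have Qt (k : 'I_N) : g t k = 0 -> m * Q k = - c * g t0 k by move=> gk; rewrite -cm gk; ring.
have Qt0 (k : 'I_N) : g t0 k = 0 -> m * Q k = c * g t k by move=> gk; rewrite -cm gk; ring.
have cube (x y z : int) : m ^+ 3 * (x * y * z) = m * x * (m * y) * (m * z) by ring.
rewrite /R !cube (Qt0 t0.1.1) ?(Qt0 t0.1.2) ?(Qt0 t0.2) ?(Qt t.1.1) ?(Qt t.1.2) ?(Qt t.2);
  try by apply/eqP; rewrite g_eq0 eqxx ?orbT.
rewrite /g; ring.
Qed.

Hypothesis V_close : {in V &, forall t t',
  [/\ 4 * `|s1 t - s1 t'| <= n, 4 * `|s2 t - s2 t'| <= n ^+ 2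
     & 4 * `|s3 t - s3 t'| <= n ^+ 3]}.

(** The first clause says without division that [alpha] reduces to [a] in [F]; the height bounds are
    what makes such an [alpha] unique. *)
Definition rational_shift (alpha : rat) :=
  [/\ (numq alpha)%:~R = a * (denq alpha)%:~R, 2 * `|numq alpha| <= n ^+ 9
     & 2 * denq alpha <= n ^+ 8].

Lemma noncollinear_shift t0 t1 t2 : t0 \in V -> t1 \in V -> t2 \in V ->
  ~ [/\ (s1 t1 - s1 t0) * (s2 t2 - s2 t0) = (s2 t1 - s2 t0) * (s1 t2 - s1 t0),
        (s1 t1 - s1 t0) * (s3 t2 - s3 t0) = (s3 t1 - s3 t0) * (s1 t2 - s1 t0) &
        (s2 t1 - s2 t0) * (s3 t2 - s3 t0) = (s3 t1 - s3 t0) * (s2 t2 - s2 t0)] ->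
  exists alpha eta : rat, rational_shift alpha /\
    forall t, t \in V ->
      (alpha + (t.1.1%:Z)%:~R)^-1 + (alpha + (t.1.2%:Z)%:~R)^-1 + (alpha + (t.2%:Z)%:~R)^-1 = eta.
Proof.
move=> t0V t1V t2V noncol.
have abs4 (z m : int) : 4 * `|z| <= m -> `|4 * z| <= m by rewrite normrM.
have norm_le (z m : int) : 0 <= z <= m -> `|z| <= m by move=> /andP[? ?]; rewrite ger0_norm.
pose w0 := lam * a ^+ 3 - 3 * a ^+ 2; pose w1 := lam * a ^+ 2 - 2 * a.
pose w2 := lam * a - 1.
have w_diff t t' : t \in V -> t' \in V ->
    w1 * (s1 t - s1 t')%:~R + w2 * (s2 t - s2 t')%:~R + lam * (s3 t - s3 t')%:~R = 0.
  exact: V_diff.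
(* [(C, B, A)] is the cross product of the two difference vectors, the normal of the plane; the
   factor 16 clears the two factors 1/4 of [V_close]. *)
have [A [B [C [[A_le B_le C_le] CA BA ABC]]]] : exists A B C : int,
  [/\ [/\ `|16 * A| <= 2 * n ^+ 3, `|16 * B| <= 2 * n ^+ 4 & `|16 * C| <= 2 * n ^+ 5],
     lam * C%:~R = w1 * A%:~R, lam * B%:~R = w2 * A%:~R &
     ~ [/\ A = 0, B = 0 & C = 0]].
  have [/abs4 + /abs4 + /abs4] := V_close t1V t0V.
  have [/abs4 + /abs4 + /abs4] := V_close t2V t0V.
  have := w_diff _ _ t2V t0V; have := w_diff _ _ t1V t0V; move: noncol.
  move: (s1 t1 - _) (s2 t1 - _) (s3 t1 - _) (s1 t2 - _) (s2 t2 - _) (s3 t2 - _).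
  move=> d1 d2 d3 e1 e2 e3 noncol eq_d eq_e e1_le e2_le e3_le d1_le d2_le d3_le.
  exists (d1 * e2 - d2 * e1), (d3 * e1 - d1 * e3), (d2 * e3 - d3 * e2).
  have [eqC eqB] := cross_proportional eq_d eq_e.
  split=> //.
    split.
    - have -> : 16 * (d1 * e2 - d2 * e1) = 4 * d1 * (4 * e2) - 4 * d2 * (4 * e1) by ring.
      by have := norm_subM d1_le e2_le d2_le e1_le; congr (_ <= _); ring.
    - have -> : 16 * (d3 * e1 - d1 * e3) = 4 * d3 * (4 * e1) - 4 * d1 * (4 * e3) by ring.
      by have := norm_subM d3_le e1_le d1_le e3_le; congr (_ <= _); ring.
    have -> : 16 * (d2 * e3 - d3 * e2) = 4 * d2 * (4 * e3) - 4 * d3 * (4 * e2) by ring.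
    by have := norm_subM d2_le e3_le d3_le e2_le; congr (_ <= _); ring.
  move=> [A0 B0 C0]; apply: noncol.
  by split; apply/eqP; rewrite -subr_eq0; apply/eqP; rewrite // -oppr0 -B0 opprB.
have [D0 D0E] : exists D0, D0 = - (C * s1 t0 + B * s2 t0 + A * s3 t0) by eexists.
have D_le : `|16 * D0| <= 14 * n ^+ 6.
  have [/norm_le s1_le /norm_le s2_le /norm_le s3_le] := s_range t0.
  have -> : 16 * D0 = - (16 * C * s1 t0 + 16 * B * s2 t0 + 16 * A * s3 t0) by rewrite D0E; ring.
  rewrite normrN; have := norm_add3M C_le B_le A_le s1_le s2_le s3_le.
  by congr (_ <= _); ring.
have small16 z i c : (c + i <= 18)%N -> `|16 * z| <= 2 ^+ c * n ^+ i ->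
    z%:~R = 0 :> F -> z = 0.
  move=> le_c z_le; apply: small_pow le_c _; apply: le_trans z_le.
  by rewrite normrM ler_peMl.
(* If [A = 0], the proportionality with [lam] invertible kills [B] and [C] in [F], hence over the
   integers. *)
have A_neq0 : A != 0.
  apply/negP => /eqP A0; apply: ABC; split=> //.
    apply: (@small16 _ 4 1) => //; apply: (mulfI lam_neq0).
    by rewrite BA A0 !mulr0.
  apply: (@small16 _ 5 1) => //; apply: (mulfI lam_neq0).
  by rewrite CA A0 !mulr0.
have AF_neq0 : A%:~R != 0 :> F.
  by apply: contraNneq A_neq0 => /(@small16 _ 3 1 isT A_le) ->.
have plane t : t \in V -> C * s1 t + B * s2 t + A * s3 t + D0 = 0.
  move=> tV; have [/abs4 f1_le /abs4 f2_le /abs4 f3_le] := V_close tV t0V.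
  pose z := C * (s1 t - s1 t0) + B * (s2 t - s2 t0) + A * (s3 t - s3 t0).
  rewrite (_ : _ + D0 = z); last by rewrite /z D0E; ring.
  apply: (@small_pow _ 6 3) => //.
    have := norm_add3M C_le B_le A_le f1_le f2_le f3_le.
    have -> : 16 * C * (4 * (s1 t - s1 t0)) + 16 * B * (4 * (s2 t - s2 t0))
      + 16 * A * (4 * (s3 t - s3 t0)) = 64 * z by rewrite /z; ring.
    rewrite normrM; have := exprn_ge0 6 (le_trans _ n_ge2 : 0 <= n).
    have -> : 2 * n ^+ 5 * n + 2 * n ^+ 4 * n ^+ 2 + 2 * n ^+ 3 * n ^+ 3 = 6 * n ^+ 6 by ring.
    by move: (n ^+ 6); clear; lia.
  apply: (mulfI lam_neq0); rewrite mulr0 /z !(rmorphD, rmorphM) /= !mulrDr !mulrA CA BA.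
  by rewrite -[RHS](mulr0 A%:~R) -(w_diff _ _ tV t0V); ring.
have DA : lam * D0%:~R = w0 * A%:~R.
  rewrite D0E rmorphN !rmorphD !rmorphM /= mulrN !mulrDr !mulrA CA BA.
  apply/eqP; rewrite -subr_eq0 -(mulr0 (- A%:~R)) -(V_eq t0V); apply/eqP.
  by rewrite /w0 /w1 /w2; ring.
have [H0 H0E] : exists H0, H0 = B ^+ 2 - A * C by eexists.
have [H1 H1E] : exists H1, H1 = B * C - A * D0 by eexists.
have [H2 H2E] : exists H2, H2 = C ^+ 2 - B * D0 by eexists.
have H0_le : `|256 * H0| <= 8 * n ^+ 8.
  have -> : 256 * H0 = 16 * B * (16 * B) - 16 * A * (16 * C) by rewrite H0E; ring.
  by have := norm_subM B_le B_le A_le C_le; congr (_ <= _); ring.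
have H1_le : `|256 * H1| <= 32 * n ^+ 9.
  have -> : 256 * H1 = 16 * B * (16 * C) - 16 * A * (16 * D0) by rewrite H1E; ring.
  by have := norm_subM B_le C_le A_le D_le; congr (_ <= _); ring.
have H2_le : `|256 * H2| <= 32 * n ^+ 10.
  have -> : 256 * H2 = 16 * C * (16 * C) - 16 * B * (16 * D0) by rewrite H2E; ring.
  by have := norm_subM C_le C_le B_le D_le; congr (_ <= _); ring.
have lamA : lam ^+ 2 * H0%:~R = A%:~R ^+ 2.
  rewrite H0E rmorphB rmorphXn rmorphM /=.
  transitivity ((lam * B%:~R) ^+ 2 - lam * A%:~R * (lam * C%:~R)); first by ring.
  by rewrite BA CA /w1 /w2; ring.
have H0F : H0%:~R != 0 :> F.
  apply/negP => /eqP H00; move: lamA; rewrite H00 mulr0 => /esym/eqP.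
  by rewrite expf_eq0 (negPf AF_neq0).
have lam2 : lam ^+ 2 != 0 by rewrite expf_neq0.
have H1F : H1%:~R = 2 * a * H0%:~R :> F.
  apply: (mulfI lam2); rewrite mulrCA lamA H1E rmorphB !rmorphM /=.
  transitivity (lam * B%:~R * (lam * C%:~R) - lam * A%:~R * (lam * D0%:~R)); first by ring.
  by rewrite BA CA DA /w0 /w1 /w2; ring.
have H2F : H2%:~R = a ^+ 2 * H0%:~R :> F.
  apply: (mulfI lam2); rewrite mulrCA lamA H2E rmorphB rmorphXn !rmorphM /=.
  transitivity ((lam * C%:~R) ^+ 2 - lam * B%:~R * (lam * D0%:~R)); first by ring.
  by rewrite BA CA DA /w0 /w1 /w2; ring.
have H0_le' : `|32 * H0| <= n ^+ 8.
  by move: H0_le; rewrite !normrM; move: (n ^+ 8) `|H0|; clear; lia.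
have H1_le' : `|8 * H1| <= n ^+ 9.
  by move: H1_le; rewrite !normrM; move: (n ^+ 9) `|H1|; clear; lia.
have H2_le' : `|8 * H2| <= n ^+ 10.
  by move: H2_le; rewrite !normrM; move: (n ^+ 10) `|H2|; clear; lia.
(* In [F] the triple [(H0, H1, H2)] is proportional to [(1, 2 a, a^2)], so [H1^2 - 4 H0 H2] vanishes
   there; its size is below [n^18]. *)
have disc : H1 ^+ 2 = 4 * H0 * H2.
  apply/eqP; rewrite -subr_eq0; apply/eqP; apply: (@small_pow _ 18 0) => //.
    have := norm_subM H1_le' H1_le' H0_le' H2_le'.
    have -> : 8 * H1 * (8 * H1) - 32 * H0 * (8 * H2) = 64 * (H1 ^+ 2 - 4 * H0 * H2) by ring.
    have -> : n ^+ 9 * n ^+ 9 + n ^+ 8 * n ^+ 10 = 2 * n ^+ 18 by ring.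
    rewrite normrM expr0 mul1r; move: (normr_ge0 (H1 ^+ 2 - 4 * H0 * H2)).
    by move: (n ^+ 18) `|H1 ^+ 2 - _|; clear; lia.
  by rewrite rmorphB rmorphXn !rmorphM /= H1F H2F; ring.
have H0_neq0 : H0 != 0 by apply: contraNneq H0F => ->.
pose alpha : rat := H1%:~R / (2 * H0)%:~R.
have two_neq0 : 2%:~R != 0 :> F.
  by apply/eqP => /(@small_pow _ 0 1 isT) two0; have := two0 isT.
(* [k] is the factor cancelled in reducing the fraction, so the height of [alpha] is bounded through
   [H1] and [2 * H0]. *)
have [k [k_neq0 H1k H0k]] : exists k : int,
    [/\ k != 0, H1 = k * numq alpha & 2 * H0 = k * denq alpha].
  rewrite /alpha; have : 2 * H0 != 0 by rewrite mulf_neq0.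
  by case: divqP => [|k x k0]; [rewrite eqxx | exists k].
have k_ge1 : 1 <= `|k| by rewrite -gtz0_ge1 normr_gt0.
have good : rational_shift alpha.
  split.
  - have kF : k%:~R != 0 :> F.
      apply: contraNneq H0F => k0; have := congr1 (intmul 1 : int -> F) H0k.
      by rewrite !rmorphM /= k0 mul0r => /eqP; rewrite mulf_eq0 (negPf two_neq0).
    apply: (mulfI kF); rewrite -intrM -H1k H1F mulrCA -intrM -H0k intrM.
    by ring.
  - apply: le_trans (_ : 2 * `|H1| <= _).
      by rewrite H1k normrM ler_pM2l // ler_peMl.
    by move: H1_le'; rewrite normrM; move: (normr_ge0 H1); move: (n ^+ 9) `|H1|; clear; lia.
  apply: le_trans (_ : 2 * `|2 * H0| <= _).
    by rewrite H0k normrM ler_pM2l // (gtr0_norm (denq_gt0 _)) ler_peMl // ltW.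
  by move: H0_le'; rewrite !normrM; move: (normr_ge0 H0); move: (n ^+ 8) `|H0|; clear; lia.
exists alpha, (A%:~R / (A%:~R * alpha - B%:~R)); split=> // t tV.
have shift_neq0 (x : 'I_N) : alpha + (x%:Z)%:~R != 0.
  apply/negP => /eqP eq0; case: good => good _ _.
  have : numq alpha + denq alpha * x%:Z = 0.
    apply: (@intr_inj rat); rewrite rmorphD rmorphM /= numqE mulrC -mulrDr.
    by rewrite eq0 mulr0.
  move/(congr1 (intmul 1 : int -> F)); rewrite rmorphD rmorphM /= good mulrC -mulrDr => /eqP.
  rewrite mulf_eq0 (negPf (a_neq0 x)) orbF => /eqP den0.
  have : k%:~R * (denq alpha)%:~R = 0 :> F by rewrite den0 mulr0.
  rewrite -intrM -H0k intrM => /eqP.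
  by rewrite mulf_eq0 (negPf H0F) (negPf two_neq0).
have cast_neq0 (z : int) : z != 0 -> z%:~R != 0 :> rat by rewrite intr_eq0.
have H0r : H0%:~R = B%:~R ^+ 2 - A%:~R * C%:~R :> rat by rewrite H0E rmorphB rmorphXn rmorphM.
have H1r : H1%:~R = B%:~R * C%:~R - A%:~R * D0%:~R :> rat by rewrite H1E rmorphB !rmorphM.
have H2r : H2%:~R = C%:~R ^+ 2 - B%:~R * D0%:~R :> rat by rewrite H2E rmorphB rmorphXn rmorphM.
have [||||eqC eqD] := @double_root_hessian rat A%:~R B%:~R C%:~R D0%:~R alpha.
- by [].
- by rewrite -H0r cast_neq0.
- have := congr1 (intmul 1 : int -> rat) disc.
  by rewrite -H0r -H1r -H2r rmorphXn !rmorphM.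
- by rewrite -H0r -H1r /alpha rmorphM.
apply: (@sum_inv_degenerate rat _ _ C%:~R D0%:~R) => //; first exact: cast_neq0.
have := congr1 (intmul 1 : int -> rat) (plane t tV).
by rewrite /s1 /s2 /s3 !(rmorphM, rmorphD) /=.
Qed.

End Class.

(** The cross difference of the two fractions vanishes in [F] and is at most [n^17 / 2] in size, so
    it is zero. *)
Let shift_unique alpha beta :
  rational_shift alpha -> rational_shift beta -> alpha = beta.
Proof.
case=> cong1 num1 den1 [cong2 num2 den2]; apply/eqP; rewrite rat_eq -subr_eq0; apply/eqP.
apply: (@small_pow _ 17 0) => //.
  have abs2 (z m : int) : 2 * `|z| <= m -> `|2 * z| <= m by rewrite normrM.
  have den_le gamma : 2 * denq gamma <= n ^+ 8 -> `|2 * denq gamma| <= n ^+ 8.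
    by move=> ?; rewrite ger0_norm // mulr_ge0 // ltW.
  have := norm_subM (abs2 _ _ num1) (den_le _ den2) (abs2 _ _ num2) (den_le _ den1).
  have -> : 2 * numq alpha * (2 * denq beta) - 2 * numq beta * (2 * denq alpha) =
    4 * (numq alpha * denq beta - numq beta * denq alpha) by ring.
  have -> : n ^+ 9 * n ^+ 8 + n ^+ 9 * n ^+ 8 = 2 * n ^+ 17 by ring.
  rewrite normrM expr0 mul1r; move: (normr_ge0 (numq alpha * denq beta - numq beta * denq alpha)).
  by move: (n ^+ 17) `|numq alpha * _ - _|; clear; lia.
by rewrite rmorphB !rmorphM /= cong1 cong2; ring.
Qed.

Let shift_bound alpha (k : 'I_N) : rational_shift alpha ->
  (0 < `|(numq alpha + denq alpha * k%:Z)%R| <= N ^ 9)%N.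
Proof.
case=> cong num_le den_le; have den_gt0 := denq_gt0 alpha.
apply/andP; split.
  rewrite absz_gt0; apply/eqP => /(congr1 (intmul 1 : int -> F)).
  rewrite rmorphD rmorphM /= cong mulrC -mulrDr => /eqP.
  rewrite mulf_eq0 (negPf (a_neq0 k)) orbF => /eqP /(@small_pow _ 8 0 isT) den0.
  suff: denq alpha = 0 by move=> eq0; rewrite eq0 ltxx in den_gt0.
  apply: den0; rewrite expr0 mul1r gtr0_norm //.
  by move: den_le den_gt0; move: (n ^+ 8) (denq alpha); clear; lia.
rewrite -lez_nat abszE -[X in _ <= X]natz natrX natz -/n.
have [k_ge0 k_lt] := andP (ord_int k).
have : `|numq alpha + denq alpha * k%:Z| <= `|numq alpha| + denq alpha * n.
  apply: le_trans (ler_normD _ _) _; rewrite lerD2l normrM (gtr0_norm den_gt0).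
  by rewrite ler_pM2l // ger0_norm // ltW.
have : 2 * (denq alpha * n) <= n ^+ 9.
  by rewrite mulrA [n ^+ 9]exprSr ler_wpM2r //; lia.
move: num_le; move: `|numq alpha + _| `|numq alpha| (n ^+ 9) (denq alpha * n).
by clear; lia.
Qed.

(** * Counting over all fibers *)

Let shift_sum (alpha : rat) (t : T3) : rat :=
  (alpha + (t.1.1%:Z)%:~R)^-1 + (alpha + (t.1.2%:Z)%:~R)^-1 + (alpha + (t.2%:Z)%:~R)^-1.

(** Scaling by the denominator turns [alpha + k] into integers of size at most [M = N^9]; hence the
    divisor bound up to [M^5 = N^45]. *)
Let card_shift_pairs alpha : rational_shift alpha ->
  (#|fiber_pairs (shift_sum alpha) [set: T3]| <= 2 * N ^ 3 * (4 * D ^ 2) ^ 6)%N.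
Proof.
move=> good; have v_neq0 := denq_neq0 alpha.
have D_bound' m : (0 < m <= (N ^ 9) ^ 5)%N -> (size (divisors m) <= D)%N.
  by rewrite -expnM; apply: D_bound.
have := card_reciprocal_solutions (ltnW N_gt1) D_bound' v_neq0 (coprime_num_den alpha)
  (fun k => shift_bound k good).
apply: leq_trans; pose flat (z : T3 * T3) :=
  (z.1.1.1, z.1.1.2, z.1.2, z.2.1.1, z.2.1.2, z.2.2).
apply: (card_le_in (f := flat)) => [[[[a1 a2] a3] [[a4 a5] a6]] [[[b1 b2] b3] [[b4 b5] b6]]|].
  by move=> _ _ [-> -> -> -> -> ->].
move=> [[[k1 k2] k3] [[k4 k5] k6]]; rewrite !inE /= /shift_sum /= => /eqP eq_sum.
have shiftE (k : 'I_N) : (numq alpha + denq alpha * k%:Z)%:~R^-1 =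
    (denq alpha)%:~R^-1 * (alpha + (k%:Z)%:~R)^-1 :> rat.
  by rewrite -invfM mulrDr [_ * alpha]mulrC -numqE rmorphD rmorphM.
by apply/eqP; rewrite !shiftE -!mulrDr eq_sum.
Qed.

(* For [lam = 0] the linear equation does not involve [s3]; for [lam = rec x] the
   fiber can contain all [(x, y, z)] with [rec y + rec z = 0]. *)
Let exceptional : {set T3} := [set t | (L t == 0) || [exists k, L t == rec k]].

(** There are at most [N + 1] exceptional values, and [card_triples] bounds each fiber by
    [5 * D * N]. *)
Let card_exceptional : (#|fiber_pairs L exceptional| <= 50 * D ^ 2 * N ^ 3)%N.
Proof.
apply: (@leq_trans ((5 * D * N) ^ 2 * size (0 :: [seq rec k | k <- enum 'I_N]))).
  apply: (card_le_fibers (f := fun z : T3 * T3 => L z.1)) => [z|v].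
    rewrite !inE => /and3P[/orP[->//|/existsP[k /eqP ->]] _ _].
    by rewrite map_f ?orbT // mem_enum.
  rewrite expnS expn1; apply: leq_trans (leq_mul (card_triples v) (card_triples v)).
  rewrite -cardsX; apply/subset_leq_card/subsetP => z; rewrite !inE.
  by move=> /andP[/and3P[_ _ /eqP <-] ->].
rewrite /= size_map size_enum_ord !expnMn.
have -> : (50 * D ^ 2 * N ^ 3 = 5 ^ 2 * D ^ 2 * N ^ 2 * (2 * N))%N by ring.
by rewrite leq_mul2l; apply/orP; right; move: N_gt1; clear; lia.
Qed.

(* Restricting to a cell gains the constant needed to compare [O(N^18)] with [p]. *)
Let cell (t : T3) : 'I_13 * 'I_13 * 'I_5 :=
  (inord (4 * `|s1 t| %/ N), inord (4 * `|s2 t| %/ N ^ 2), inord (4 * `|s3 t| %/ N ^ 3))%N.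

(** The bound [4 * c <= b] keeps both quotients in the range of [inord]; numbers with equal
    quotients by [m] differ by less than [m]. *)
Let cell_close (x y C W : int) (m b c : nat) : C = c%:Z -> W = m%:Z ->
  (0 < m)%N -> (4 * c <= b)%N -> 0 <= x <= C * W -> 0 <= y <= C * W ->
  (inord (4 * `|x| %/ m) : 'I_b.+1) = inord (4 * `|y| %/ m) -> 4 * `|x - y| <= W.
Proof.
move=> -> -> m_gt0 le_b; case: x => // x; case: y => // y; rewrite !absz_nat.
move=> /andP[_ x_le] /andP[_ y_le] /(congr1 val).
have lt_b z : z%:Z <= c%:Z * m%:Z -> (4 * z %/ m < b.+1)%N.
  rewrite -PoszM lez_nat ltnS => z_le; rewrite -(leq_pmul2r m_gt0).
  apply: leq_trans (leq_trunc_div _ _) _.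
  by rewrite (@leq_trans (4 * c * m)) ?leq_mul2r ?le_b ?orbT // -mulnA leq_mul2l z_le.
rewrite /= !inordK ?lt_b // => eq_q.
have := divn_eq (4 * x) m; have := divn_eq (4 * y) m; rewrite eq_q.
have := ltn_pmod (4 * x) m_gt0; have := ltn_pmod (4 * y) m_gt0.
move: (_ * m)%N ((4 * x) %% m)%N ((4 * y) %% m)%N => q r1 r2.
by clear; lia.
Qed.

Let cell_inj t t' : cell t = cell t' ->
  [/\ 4 * `|s1 t - s1 t'| <= n, 4 * `|s2 t - s2 t'| <= n ^+ 2
     & 4 * `|s3 t - s3 t'| <= n ^+ 3].
Proof.
have N_gt0 i : (0 < N ^ i)%N by rewrite expn_gt0 (ltnW N_gt1).
have [a1 a2 a3] := s_range t; have [b1 b2 b3] := s_range t'; move=> eq_c.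
split.
- apply: (@cell_close _ _ 3 n N 12 3) => //; first exact: (N_gt0 1%N).
  exact: (congr1 (fun c => c.1.1) eq_c).
- apply: (@cell_close _ _ 3 (n ^+ 2) (N ^ 2)%N 12 3) => //.
  exact: (congr1 (fun c => c.1.2) eq_c).
apply: (@cell_close _ _ 1 (n ^+ 3) (N ^ 3)%N 4 1); rewrite ?mul1r //.
exact: (congr1 (fun c => c.2) eq_c).
Qed.

Let class (t : T3) : {set T3} :=
  [set t' in ~: exceptional | (L t' == L t) && (cell t' == cell t)].

(** By [card_collinear] so large a class contains three non-collinear points, and
    [noncollinear_shift] applies. *)
Let class_shift t : t \in ~: exceptional -> (64 * D ^ 3 < #|class t|)%N ->
  exists2 alpha, rational_shift alpha &
    forall t', t' \in class t -> shift_sum alpha t' = shift_sum alpha t.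
Proof.
move=> t_ord big_class.
have tV : t \in class t by rewrite inE t_ord !eqxx.
move: t_ord; rewrite !inE negb_or => /andP[L_neq0 /existsPn L_rec].
have VL t' : t' \in class t -> L t' = L t.
  by rewrite inE => /and3P[_ /eqP].
have V_close : {in class t &, forall t1 t2,
  [/\ 4 * `|s1 t1 - s1 t2| <= n, 4 * `|s2 t1 - s2 t2| <= n ^+ 2
     & 4 * `|s3 t1 - s3 t2| <= n ^+ 3]}.
  move=> t1 t2; rewrite !inE => /and3P[_ _ /eqP c1] /and3P[_ _ /eqP c2].
  by apply: cell_inj; rewrite c1 c2.
pose col t0 t1 t2 := [&& (s1 t1 - s1 t0) * (s2 t2 - s2 t0) == (s2 t1 - s2 t0) * (s1 t2 - s1 t0),
        (s1 t1 - s1 t0) * (s3 t2 - s3 t0) == (s3 t1 - s3 t0) * (s1 t2 - s1 t0) &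
        (s2 t1 - s2 t0) * (s3 t2 - s3 t0) == (s3 t1 - s3 t0) * (s2 t2 - s2 t0)].
have [all_col|] := boolP [forall t0 in class t,
  forall t1 in class t, forall t2 in class t, col t0 t1 t2].
  have := card_collinear L_neq0 L_rec VL; rewrite leqNgt big_class => absurd.
  suff: false by []; apply: absurd => t0 t1 t2 t0V t1V t2V.
  move/forall_inP/(_ _ t0V)/forall_inP/(_ _ t1V)/forall_inP/(_ _ t2V): all_col.
  by move=> /and3P[/eqP ? /eqP ? /eqP ?].
move=> /forall_inPn[t0 t0V /forall_inPn[t1 t1V /forall_inPn[t2 t2V ncol]]].
have [|alpha [eta [good sum_eta]]] := noncollinear_shift L_neq0 VL V_close t0V t1V t2V.
  by case=> e1 e2 e3; case/negP: ncol; rewrite /col e1 e2 e3 !eqxx.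
by exists alpha => // t' t'V; rewrite /shift_sum !sum_eta.
Qed.

(** In a small class each triple has at most [64 * D ^ 3] partners. All large classes share one
    [alpha] by [shift_unique], so a single use of [card_shift_pairs] covers them together. *)
Let card_ordinary_pairs :
  (#|fiber_pairs (fun t => (L t, cell t)) (~: exceptional)| <=
     64 * D ^ 3 * N ^ 3 + 2 * N ^ 3 * (4 * D ^ 2) ^ 6)%N.
Proof.
set P := fiber_pairs _ _; pose big := [set z : T3 * T3 | (64 * D ^ 3 < #|class z.1|)%N].
rewrite -(cardsID big P) addnC leq_add //.
  have -> : (N ^ 3 = size (enum {: T3}))%N.
    by rewrite -cardE !card_prod card_ord !expnSr mul1n.
  apply: (card_le_fibers (f := fst)) => [z _|t]; first by rewrite mem_enum.
  have [big_t|small_t] := ltnP (64 * D ^ 3) #|class t|.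
    apply: (@leq_trans 0); rewrite // leqn0 cards_eq0; apply/eqP.
    apply/setP => z; rewrite in_set0 inE; apply/negP => /andP[+ /eqP eq_t].
    by rewrite in_setD [z \in big]inE eq_t big_t.
  apply: leq_trans small_t; apply: (card_le_in (f := snd)) => [[x y] [x' y']|[x y]].
    by rewrite !inE /= => /andP[_ /eqP ->] /andP[_ /eqP ->] ->.
  rewrite !inE /= => /andP[/andP[_ /and3P[_ y_ord /eqP eq_xy]] /eqP eq_t].
  by rewrite y_ord -xpair_eqE -eq_t -eq_xy eqxx.
have Pbig z : z \in P :&: big -> exists2 alpha, rational_shift alpha &
    shift_sum alpha z.1 = shift_sum alpha z.2.
  rewrite inE => /andP[]; rewrite [z \in big]inE => /[swap] big_z.
  rewrite inE => /and3P[z1 z2 /eqP eq_z].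
  have [alpha good eq_sum] := class_shift z1 big_z.
  by exists alpha => //; rewrite eq_sum // inE z2 -xpair_eqE -eq_z eqxx.
have [->|[z0 /Pbig[alpha good _]]] := set_0Vmem (P :&: big); first by rewrite cards0.
apply: leq_trans (card_shift_pairs good); apply/subset_leq_card/subsetP => z.
move=> /Pbig[beta good' eq_sum]; rewrite (shift_unique good good') !inE.
by rewrite eq_sum eqxx.
Qed.

(** Triples with equal [L] are both exceptional or both ordinary; for the latter, refining by cells
    costs their number [13 * 13 * 5]. *)
Lemma card_triple_pairs :
  (#|fiber_pairs L [set: T3]| <= 50 * D ^ 2 * N ^ 3 +
    13 * 13 * 5 * (64 * D ^ 3 * N ^ 3 + 2 * N ^ 3 * (4 * D ^ 2) ^ 6))%N.
Proof.
have split_pairs : (fiber_pairs L [set: T3] \subset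
    fiber_pairs L exceptional :|: fiber_pairs L (~: exceptional)).
  apply/subsetP => z; rewrite [z \in fiber_pairs _ _]inE => /and3P[_ _ eq_z].
  have exc_eq : (z.1 \in exceptional) = (z.2 \in exceptional).
    by rewrite !inE (eqP eq_z).
  rewrite in_setU [z \in fiber_pairs L exceptional]inE [z \in fiber_pairs L (~: _)]inE.
  by rewrite eq_z !in_setC exc_eq; case: (z.2 \in _).
apply: leq_trans (subset_leq_card split_pairs) _.
apply: leq_trans (leq_card_setU _ _) _; apply: leq_add card_exceptional _.
apply: leq_trans (card_fiber_pairs_refine L cell _) _.
apply: leq_mul card_ordinary_pairs.
by rewrite !card_prod !card_ord.
Qed.

End Modular.

(** * Asymptotics *)

Definition reciprocal_sum (F : fieldType) (a : F) N (t : 'I_N * 'I_N * 'I_N) : F :=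
  (a + (t.1.1%:Z)%:~R)^-1 + (a + (t.1.2%:Z)%:~R)^-1 + (a + (t.2%:Z)%:~R)^-1.

Lemma Fp_intr_eq0 p (z : int) : prime p -> `|z| < p%:Z -> z%:~R = 0 :> 'F_p -> z = 0.
Proof.
move=> p_pr z_lt z0; have : (`|z|%N)%:R = 0 :> 'F_p.
  rewrite pmulrn abszE; case: (ger0P z) => // _.
  by rewrite rmorphN /= z0 oppr0.
move/eqP; rewrite -(dvdn_pcharf (pchar_Fp p_pr)) => p_dvd.
apply/eqP; rewrite -absz_eq0 -leqn0 leqNgt; apply/negP => z_gt0.
by move: p_dvd; rewrite gtnNdvd // -ltz_nat abszE.
Qed.

Lemma interval_parametrization p (I : {set 'F_p}) :
    prime p -> is_interval I -> 0 \notin I ->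
  exists N (a : 'F_p), [/\ (0 < N)%N, #|I| = N, I = [set a + (k%:Z)%:~R | k : 'I_N] &
    forall k : 'I_N, a + (k%:Z)%:~R != 0].
Proof.
move=> p_pr [M [N [/andP[N_gt0 N_le] ->]]] I0.
pose a : 'F_p := (M + 1)%:~R.
have shiftE k : (M + k.+1%:Z)%:~R = a + (k%:Z)%:~R.
  by rewrite /a -rmorphD; congr _%:~R; lia.
exists N, a; split => //.
- rewrite card_imset ?card_ord // => k l; rewrite !shiftE => /addrI /eqP.
  rewrite -subr_eq0 -rmorphB => /eqP /(Fp_intr_eq0 p_pr) kl; apply: val_inj => /=.
  have := ltn_ord k; have := ltn_ord l => lt_l lt_k.
  have : k%:Z - l%:Z = 0 by apply: kl; lia.
  by lia.
- by apply: eq_imset => k; apply: shiftE.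
move=> k; apply: contraNneq I0 => <-; rewrite -shiftE; exact: imset_f.
Qed.

(** * From pairs of triples of indices to [J6] and the sumset *)

Section IntervalCounts.

Variables (F : finFieldType) (a : F) (N : nat).

Let I : {set F} := [set a + (k%:Z)%:~R | k : 'I_N].

Lemma J6_le_fiber_pairs : (J6 I <= #|fiber_pairs (@reciprocal_sum F a N) setT|)%N.
Proof.
pose x (k : 'I_N) : F := a + (k%:Z)%:~R.
pose flat (z : ('I_N * 'I_N * 'I_N) * ('I_N * 'I_N * 'I_N)) :=
  (x z.1.1.1, x z.1.1.2, x z.1.2, x z.2.1.1, x z.2.1.2, x z.2.2).
apply: leq_trans (leq_imset_card flat _); apply/subset_leq_card/subsetP.
move=> [[[[[x1 x2] x3] x4] x5] x6]; rewrite inE.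
move=> /and5P[/imsetP[k1 _ ->] /imsetP[k2 _ ->] /imsetP[k3 _ ->] /imsetP[k4 _ ->]].
move=> /and3P[/imsetP[k5 _ ->] /imsetP[k6 _ ->] eq_sum].
apply/imsetP; exists ((k1, k2, k3), (k4, k5, k6)); last by [].
by rewrite !inE.
Qed.

Lemma card_sq_le_sumset : (N ^ 6 <= #|sumset (sumset (invset I) (invset I)) (invset I)| *
  #|fiber_pairs (@reciprocal_sum F a N) setT|)%N.
Proof.
have -> : (N ^ 6 = #|[set: 'I_N * 'I_N * 'I_N]| ^ 2)%N.
  by rewrite cardsT !card_prod card_ord; ring.
apply: leq_trans (card_sq_le_fiber_pairs (@reciprocal_sum F a N) _) _.
rewrite leq_mul2r; apply/orP; right; apply/subset_leq_card/subsetP => _ /imsetP[t _ ->].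
have inv (k : 'I_N) : (a + (k%:Z)%:~R)^-1 \in invset I.
  by apply: imset_f; apply/imsetP; exists k.
by rewrite /reciprocal_sum; apply: imset2_f; rewrite // imset2_f.
Qed.

End IntervalCounts.

Lemma max_size_divisors (R : realType) (eps : R) : 0 < eps ->
  exists2 C : R, 0 < C & forall N, (0 < N)%N ->
    exists2 D, (D%:R ^+ 12 <= C * N%:R `^ eps) &
      (0 < D)%N /\ forall m, (0 < m <= N ^ 45)%N -> (size (divisors m) <= D)%N.
Proof.
(* [K] is chosen so that [45 / K <= eps]; the divisor bound is taken with exponent [12 * K] because
   [D] enters the count to the power 12. *)
move=> eps_gt0; pose K := (Num.Def.archi_bound (45 / eps)).+1.
have K_ge : 45 <= eps * K%:R.
  have ge0 : 0 <= 45 / eps by rewrite divr_ge0 // ltW.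
  rewrite mulrC -ler_pdivrMr // ltW // (lt_le_trans (archi_boundP ge0)) //.
  by rewrite ler_nat.
have [C C_gt0 C_bound] := size_divisors_exp (isT : 0 < 12 * K)%N.
exists C%:R; first by rewrite ltr0n.
move=> N N_gt0; have N45_gt0 : (0 < N ^ 45)%N by rewrite expn_gt0 N_gt0.
pose D := (\max_(m < N ^ 45) size (divisors m.+1))%N.
have D_bound m : (0 < m <= N ^ 45)%N -> (size (divisors m) <= D)%N.
  case: m => // m /andP[_ m_lt].
  by rewrite /D (bigD1 (Ordinal m_lt)) //= leq_maxl.
exists D; last first.
  by split=> //; apply: leq_trans (D_bound 1%N _); rewrite // N45_gt0.
have D_le : (D ^ (12 * K) <= C * N ^ 45)%N.
  rewrite /D; have [|m ->] := @bigop.eq_bigmax _ (fun m : 'I_(N ^ 45) => size (divisors m.+1)).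
    by rewrite card_ord.
  by apply: leq_trans (C_bound _ _) _; rewrite // leq_mul2l ltn_ord orbT.
have N_ge1 : 1 <= N%:R :> R by rewrite ler1n.
have C_ge1 : 1 <= C%:R :> R by rewrite ler1n.
rewrite -(@ler_pXn2r _ K) ?nnegrE ?exprn_ge0 ?mulr_ge0 ?powR_ge0 ?ler0n //.
rewrite -exprM; apply: le_trans (_ : C%:R * N%:R ^+ 45 <= _).
  by rewrite -!natrX -natrM ler_nat.
rewrite exprMn; apply: ler_pM; rewrite ?exprn_ge0 ?ler0n //.
  by rewrite -[leLHS]expr1 ler_weXn2l.
rewrite -!powR_mulrn ?powR_ge0 ?ler0n // -powRrM.
exact: ler_powR.
Qed.

Lemma combine_bounds c1 c2 c3 c4 D N : (0 < D)%N ->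
  (c1 * D ^ 2 * N ^ 3 + c2 * (c3 * D ^ 3 * N ^ 3 + 2 * N ^ 3 * (c4 * D ^ 2) ^ 6) <=
   (c1 + c2 * (c3 + 2 * c4 ^ 6)) * D ^ 12 * N ^ 3)%N.
Proof.
move=> D_gt0.
have -> : ((c1 + c2 * (c3 + 2 * c4 ^ 6)) * D ^ 12 * N ^ 3 =
  c1 * D ^ 12 * N ^ 3 + c2 * (c3 * D ^ 12 * N ^ 3 + 2 * N ^ 3 * (c4 ^ 6 * D ^ 12)))%N by ring.
rewrite expnMn -expnM; have D_le i : (i <= 12)%N -> (D ^ i <= D ^ 12)%N.
  by move=> le_i; rewrite leq_pexp2l.
have scale (c i : nat) : (i <= 12)%N -> (c * D ^ i * N ^ 3 <= c * D ^ 12 * N ^ 3)%N.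
  by move=> le_i; rewrite leq_mul2r leq_mul2l D_le ?orbT.
by rewrite leq_add ?scale // leq_mul2l leq_add2r scale ?orbT.
Qed.

(** The case [N = 1] is separate, since absorbing constants into powers of [N] requires [N >= 2]. *)
Lemma card_triple_pairs_bound : exists C0, forall p (a : 'F_p) (N D : nat),
    prime p -> (0 < N)%N -> (N ^ 18 < p)%N -> (0 < D)%N ->
    (forall m, (0 < m <= N ^ 45)%N -> (size (divisors m) <= D)%N) ->
    (forall k : 'I_N, a + (k%:Z)%:~R != 0) ->
  (#|fiber_pairs (@reciprocal_sum 'F_p a N) setT| <= C0 * D ^ 12 * N ^ 3)%N.
Proof.
eexists => p a N D p_pr N_gt0 N_lt D_gt0 D_bound a_neq0.
apply: leq_trans (combine_bounds 50 (13 * 13 * 5) 64 4 N D_gt0).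
have [N_gt1|N_le1] := ltnP 1 N.
  exact: card_triple_pairs (fun z => @Fp_intr_eq0 p z p_pr) D_bound a_neq0.
have N1 : N = 1%N by apply/eqP; rewrite eqn_leq N_le1.
subst N; apply: leq_trans (max_card _) _; rewrite !card_prod !card_ord.
apply: leq_trans (leq_addr _ _).
by rewrite exp1n !muln1 muln_gt0 expn_gt0 D_gt0.
Qed.

Theorem theorem3 (R : realType) (eps : R) (eps_gt0 : 0 < eps) :
  exists c c' : R, [/\ 0 < c, 0 < c' &
    forall (p : nat) (I : {set 'F_p}),
      prime p -> is_interval I -> 0 \notin I ->
      #|I|%:R < p%:R `^ (1 / 18%:R) :> R ->
      (J6 I)%:R < c * #|I|%:R `^ (3%:R + eps) /\
      c' * #|I|%:R `^ (3%:R - eps)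
        < #|sumset (sumset (invset I) (invset I)) (invset I)|%:R].
Proof.
have [C0 C0_bound] := card_triple_pairs_bound.
have [C C_gt0 C_bound] := max_size_divisors eps_gt0.
(* The summand 1 makes the inequality strict. *)
pose c := C0%:R * C + 1.
have c_gt0 : 0 < c by rewrite ltr_wpDl // mulr_ge0 ?ler0n // ltW.
exists c, c^-1; split; rewrite ?invr_gt0 // => p I p_pr I_int I0.
have [N [a [N_gt0 -> -> a_neq0]]] := interval_parametrization p_pr I_int I0.
move=> N_lt; have {}N_lt : (N ^ 18 < p)%N.
  have p_eq : p%:R = (p%:R `^ (1 / 18%:R)) ^+ 18 :> R.
    by rewrite -powR_mulrn ?powR_ge0 // -powRrM divfK ?pnatr_eq0 // powRr1 ?ler0n.
  by rewrite -(ltr_nat R) natrX p_eq ltrXn2r ?ler0n ?powR_ge0.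
have [D D12 [D_gt0 D_bound]] := C_bound N N_gt0.
have pairs_le := C0_bound p a N D p_pr N_gt0 N_lt D_gt0 D_bound a_neq0.
set P := #|fiber_pairs _ _| in pairs_le.
have N_neq0 : N%:R != 0 :> R by rewrite pnatr_eq0 -lt0n.
have NR_gt0 : 0 < N%:R :> R by rewrite ltr0n.
have P_lt : P%:R < c * N%:R `^ (3%:R + eps).
  rewrite powRD ?N_neq0 ?implybT // powR_mulrn ?ler0n // /c.
  have Npos : 0 < N%:R ^+ 3 * N%:R `^ eps by rewrite mulr_gt0 ?exprn_gt0 ?powR_gt0.
  rewrite mulrDl mul1r; apply: le_lt_trans (_ : C0%:R * C * (N%:R ^+ 3 * N%:R `^ eps) < _).
    apply: le_trans (_ : (C0 * D ^ 12 * N ^ 3)%N%:R <= _); first by rewrite ler_nat.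
    rewrite natrM natrM !natrX.
    have -> : C0%:R * C * (N%:R ^+ 3 * N%:R `^ eps) =
      C0%:R * (C * N%:R `^ eps) * N%:R ^+ 3 by ring.
    by rewrite ler_wpM2r ?exprn_ge0 ?ler0n // ler_wpM2l ?ler0n.
  by rewrite ltrDl.
split.
  by apply: le_lt_trans P_lt; rewrite ler_nat J6_le_fiber_pairs.
have S_ge := card_sq_le_sumset a N; rewrite -/P in S_ge.
set S := #|sumset _ _| in S_ge *.
have S_gt0 : (0 < S)%N.
  by case: S S_ge => //; rewrite mul0n leqn0 expn_eq0 -leqn0 leqNgt N_gt0.
have e_gt0 : 0 < N%:R `^ (3%:R + eps) by rewrite powR_gt0.
(* Cauchy-Schwarz gives [N^6 <= S P], and [P < c N^(3 + eps)], whence the constant [c^-1]. *)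
rewrite -(ltr_pM2r e_gt0) -mulrA -powRD ?N_neq0 ?implybT //.
have -> : 3%:R - eps + (3%:R + eps) = 6%:R :> R by ring.
rewrite powR_mulrn ?ler0n // mulrC ltr_pdivrMr // -mulrA [_ * c]mulrC.
apply: le_lt_trans (_ : S%:R * P%:R < _); last by rewrite ltr_pM2l ?ltr0n.
by rewrite -natrX -natrM ler_nat.
Qed.
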